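(* Let $\rho,\gamma,L\ge 0$ and $\delta,\sigma>0$. Let $\varphi:\mathbb{R}^d\to(-\infty,+\infty]$ be a proper, lower semicontinuous, $(\rho,\gamma)$-semiconvex function such that $|\varphi(x)-\varphi(y)|\le L+L|x-y|$ for all $x,y\in\mathrm{Dom}(\varphi)$, and such that $\mathrm{Dom}(\varphi)$ satisfies the $(\gamma,\delta,\sigma)$-shifted uniform interior ball condition. Let $x_0\in\overline{\mathrm{Dom}(\varphi)}$, let $m:\mathbb{R}_+\to\mathbb{R}^d$ be continuous with $m(0)=0$, and let $T>0$. Then there exists a constant $C$, depending only on the constants from these assumptions, such that, with $C_{T,m}$ the quantity built from this $C$ as in the context, if $(x,k)=\mathcal{SP}(\partial^-\varphi;x_0,m)$ then (a) $\|k\|_{BV([0,T];\mathbb{R}^d)}=\mathrm{Var}_T(k)\le C_{T,m}$; (b) $\|x\|_T\le|x_0|+C_{T,m}$; (c) $|x(t)-x(s)|+\mathrm{Var}_t(k)-\mathrm{Var}_s(k)\le C_{T,m}\sqrt{\mu_m(t-s)}$ for all $0\le s\le t\le T$. If moreover $\hat x_0\in\overline{\mathrm{Dom}(\varphi)}$, $\hat m:\mathbb{R}_+\to\mathbb{R}^d$ is continuous with $\hat m(0)=0$, and $(\hat x,\hat k)=\mathcal{SP}(\partial^-\varphi;\hat x_0,\hat m)$, then $$\|x-\hat x\|_T+\|k-\hat k\|_T\le A(C_{T,m},C_{T,\hat m})\cdot\Big[|x_0-\hat x_0|+\sqrt{\|m-\hat m\|_T}\Big],$$ where $A$ is a continuous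 function.
   Context: Here $|\cdot|$ and $\langle\cdot,\cdot\rangle$ are the Euclidean norm and inner product, $\overline B(x,r)$ is the closed ball, $\mathrm{Bd}(E)$ is the boundary of $E$, and $\|z\|_T=\sup_{r\in[0,T]}|z(r)|$. For $\varphi:\mathbb{R}^d\to(-\infty,+\infty]$, $\mathrm{Dom}(\varphi)=\{v:\varphi(v)<+\infty\}$; $\varphi$ is proper if $\mathrm{Dom}(\varphi)$ is nonempty and has no isolated points. The Fréchet subdifferential is $\partial^-\varphi(x)=\emptyset$ if $x\notin\mathrm{Dom}(\varphi)$, and for $x\in\mathrm{Dom}(\varphi)$ $$\partial^-\varphi(x)=\Big\{\hat x\in\mathbb{R}^d:\liminf_{y\to x}\frac{\varphi(y)-\varphi(x)-\langle\hat x,y-x\rangle}{|y-x|}\ge 0\Big\}.$$ A nonempty closed set $E\subset\mathbb{R}^d$ is $\gamma$-semiconvex ($\gamma\ge0$) if for every $x\in\mathrm{Bd}(E)$ there is $\hat x\in\mathbb{R}^d\setminus\{0\}$ with $\langle\hat x,y-x\rangle\le\gamma|\hat x||y-x|^2$ for all $y\in E$. The function $\varphi$ is $(\rho,\gamma)$-semiconvex ($\rho,\gamma\ge0$) if: $\overline{\mathrm{Dom}(\varphi)}$ is $\gamma$-semiconvex; $\partial^-\varphi(x)\ne\emptyset$ for some $x$; and for all $x$, all $\hat x\in\partial^-\varphi(x)$ and all $y\in\mathbb{R}^d$, $\langle\hat x,y-x\rangle+\varphi(x)\le\varphi(y)+(\rho+\gamma|\hat x|)|y-x|^2$. A set $E$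 satisfies the $(\gamma,\delta,\sigma)$-shifted uniform interior ball condition if for every $y\in E$ there exist $\lambda_y\in(0,1]$ and $v_y\in\mathbb{R}^d$, $|v_y|\le1$, with $\lambda_y-(|v_y|+\lambda_y)^2\gamma\ge\sigma$ and $\overline B(x+v_y,\lambda_y)\subset E$ for all $x\in E\cap\overline B(y,\delta)$. $\mathrm{Var}_t(k)$ denotes the total variation of $k$ on $[0,t]$; $\|k\|_{BV([0,T];\mathbb{R}^d)}=|k(0)|+\mathrm{Var}_T(k)$; $BV_{loc}(\mathbb{R}_+;\mathbb{R}^d)$ is the set of functions with $\mathrm{Var}_t(k)<\infty$ for all $t$. A pair $(x,k)$ of continuous functions $\mathbb{R}_+\to\mathbb{R}^d$ is a solution of the generalized Skorohod problem, written $(x,k)=\mathcal{SP}(\partial^-\varphi;x_0,m)$, if: (j) $x(t)\in\overline{\mathrm{Dom}(\varphi)}$ for all $t\ge0$ and $\varphi(x(\cdot))\in L^1_{loc}(\mathbb{R}_+)$; (jj) $k\in BV_{loc}(\mathbb{R}_+;\mathbb{R}^d)$, $k(0)=0$; (jjj) $x(t)+k(t)=x_0+m(t)$ for all $t\ge0$; (jv) for all $0\le s\le t$ and all continuous $y:\mathbb{R}_+\to\mathbb{R}^d$, $$\int_s^t\langle y(r)-x(r),dk(r)\rangle+\int_s^t\varphi(x(r))dr\le\int_s^t\varphi(y(r))dr+\int_s^t|y(r)-x(r)|^2\big(\rho\,dr+\gamma\,d\mathrm{Var}_r(k)\big).$$ For $y\in C([0,T];\mathbb{R}^d)$ and $\varepsilon\in[0,T]$,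 let $\mathbf m_y(\varepsilon)=\sup\{|y(t)-y(s)|:t,s\in[0,T],|t-s|\le\varepsilon\}$ and $\mu_y(\varepsilon)=\varepsilon+\mathbf m_y(\varepsilon)$. The function $\mu_y:[0,T]\to[0,\mu_y(T)]$ is strictly increasing and continuous, and $\mu_y^{-1}:[0,\mu_y(T)]\to[0,T]$ denotes its inverse function, which is also strictly increasing and continuous. Using this inverse function, for a positive constant $C$ set $$\Delta_m=\frac{1}{\mu_m^{-1}\big(\delta^2\exp[-C(1+T+\|m\|_T)]\big)},\qquad C_{T,m}=\exp\big[C(1+T+\|m\|_T+\Delta_m)\big],$$ and similarly for $\hat m$ in place of $m$.
   Formalization: When δ²exp[−C(1+T+‖m‖_T)] exceeds μ_m(T) (e.g. m=0 and T small), the inverse μ_m^{-1} is undefined at that point; it is given the value T there, so Δ_m=1/T. The same holds for m̂. All cases where Δ_m is defined are unchanged. *)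

(* Defs.v *)
(* MathComp-Analysis: R is an arbitrary realType and R^d is 'rV[R]_d.  The
   library norm on 'rV[R]_d is the max norm; it induces the Euclidean topology,
   so closure, interior and continuity are the library notions, whereas every
   metric quantity below uses the Euclidean norm enorm. *)
From HB Require Import structures.
From mathcomp Require Import all_boot all_order all_algebra.
From mathcomp Require Import all_classical all_reals all_analysis.

Set Implicit Arguments.
Unset Strict Implicit.
Unset Printing Implicit Defensive.

Import Order.TTheory GRing.Theory Num.Theory.
Import numFieldNormedType.Exports.

Local Open Scope classical_set_scope.
Local Open Scope ring_scope.

Section SkorohodDefs.
Context {R : realType} {d : nat}.
Local Notation Rd := 'rV[R]_d.

Implicit Types (x y z k m : R -> Rd) (phi : Rd -> \bar R) (E : set Rd).

Definition dot (u v : Rd) : R := \sum_(i < d) u 0 i * v 0 i.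

Definition enorm (u : Rd) : R := Num.sqrt (dot u u).

Definition bd E : set Rd := closure E `\` interior E.

Definition edom phi : set Rd := [set v | (phi v < +oo)%E].

Definition proper_fun phi : Prop :=
  edom phi !=set0 /\ isolated (edom phi) = set0.

(* x^' is the punctured neighbourhood filter of x. *)
Definition frechet_subdiff phi (a : Rd) : set Rd :=
  [set ha | edom phi a /\
    (0 <= limf_einf (fun b : Rd =>
            (phi b - phi a - (dot ha (b - a))%:E) * ((enorm (b - a))^-1)%:E)
          (a^'))%E].

Definition set_semiconvex (gamma : R) E : Prop :=
  [/\ E !=set0, closed E &
    forall a, bd E a -> exists2 ha : Rd, ha != 0 &
      forall b : Rd, E b -> dot ha (b - a) <= gamma * enorm ha * enorm (b - a) ^+ 2].

Definition fun_semiconvex (rho gamma : R) phi : Prop :=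
  [/\ set_semiconvex gamma (closure (edom phi)),
      exists a, frechet_subdiff phi a !=set0 &
      forall a ha b : Rd, frechet_subdiff phi a ha ->
        ((dot ha (b - a))%:E + phi a
          <= phi b + ((rho + gamma * enorm ha) * enorm (b - a) ^+ 2)%:E)%E].

Definition shifted_interior_ball (gamma delta sigma : R) E : Prop :=
  forall b : Rd, E b -> exists (lam : R) (v : Rd),
    [/\ 0 < lam <= 1, enorm v <= 1,
        sigma <= lam - (enorm v + lam) ^+ 2 * gamma &
        forall a, E a -> closed_ball_ enorm b delta a ->
          closed_ball_ enorm (a + v) lam `<=` E].

Definition variation_on k (a b : R) (s : seq R) : R :=
  let p := nth b (a :: s) in
  \sum_(0 <= i < size s) enorm (k (p i.+1) - k (p i)).

Definition tvar k (t : R) : \bar R :=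
  ereal_sup [set (variation_on k 0 t s)%:E | s in itv_partition 0 t].

Definition bv_norm k (T : R) : \bar R := ((enorm (k 0))%:E + tvar k T)%E.

(* The integral int_a^b g(r) dh(r) of scalar functions in the Riemann-Stieltjes
   sense: limit, as the mesh tends to 0, of the sums over tagged partitions
   a = p 0 < ... < p (size s) = b with tags xi i in [p i, p i.+1].
   It exists whenever g is continuous and h has bounded variation on [a, b],
   and it then agrees with the Lebesgue-Stieltjes integral if h is continuous. *)
Definition is_stieltjes_int (g h : R -> R) (a b I : R) : Prop :=
  forall e : R, 0 < e -> exists2 eta : R, 0 < eta &
    forall (s : seq R) (xi : nat -> R),
      let p := nth b (a :: s) in
      itv_partition a b s ->
      (forall i, (i < size s)%N ->
         p i.+1 - p i < eta /\ p i <= xi i <= p i.+1) ->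
      `| \sum_(0 <= i < size s) g (xi i) * (h (p i.+1) - h (p i)) - I | < e.

Definition stieltjes_int (g h : R -> R) (a b : R) : R :=
  xget 0 [set I | is_stieltjes_int g h a b I].

(* int_a^b <z(r), dk(r)> *)
Definition stieltjes_dot z k (a b : R) : R :=
  \sum_(i < d) stieltjes_int (fun r => z r 0 i) (fun r => k r 0 i) a b.

(* Functions on R_+ are represented by functions on R whose values at negative
   arguments are irrelevant. *)
Definition continuous_Rplus z : Prop := {within `[0, +oo[%classic, continuous z}.

(* In the last field, rho dr + gamma dVar_r(k) is the measure whose distribution
   function is r |-> rho r + gamma Var_r(k). *)
Record skorohod_sol (rho gamma : R) phi (x0 : Rd) m x k : Prop := {
  sp_cont_x : continuous_Rplus x ;
  sp_cont_k : continuous_Rplus k ;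
  sp_dom : forall t : R, 0 <= t -> closure (edom phi) (x t) ;
  sp_L1loc : forall t : R, 0 <= t ->
    lebesgue_measure.-integrable `[0, t] (fun r => phi (x r)) ;
  sp_bv : forall t : R, 0 <= t -> (tvar k t < +oo)%E ;
  sp_k0 : k 0 = 0 ;
  sp_eq : forall t : R, 0 <= t -> x t + k t = x0 + m t ;
  sp_ineq : forall s t : R, 0 <= s <= t -> forall y, continuous_Rplus y ->
    ((stieltjes_dot (fun r => (y r - x r)%R) k s t)%:E
       + \int[lebesgue_measure]_(r in `[s, t]) phi (x r)
     <= \int[lebesgue_measure]_(r in `[s, t]) phi (y r)
       + (stieltjes_int (fun r => (enorm (y r - x r) ^+ 2)%R)
            (fun r => (rho * r + gamma * fine (tvar k r))%R) s t)%:E)%E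
}.

Definition sup_norm (T : R) z : R := sup [set enorm (z r) | r in `[0, T]].

Definition modulus (T : R) z (e : R) : R :=
  sup [set a | exists t s, [/\ t \in `[0, T], s \in `[0, T],
                               `|t - s| <= e & a = enorm (z t - z s)]].

Definition mu_mod (T : R) z (e : R) : R := e + modulus T z e.

(* The inverse of mu_mod T z : [0, T] -> [0, mu_mod T z T], extended by the
   constant T, its value at the right endpoint, outside [0, mu_mod T z T]. *)
Definition mu_inv (T : R) z : R -> R := 'pinv_(fun=> T) `[0, T] (mu_mod T z).

Definition Delta (delta C T : R) z : R :=
  (mu_inv T z (delta ^+ 2 * expR (- (C * (1 + T + sup_norm T z)))))^-1.

Definition CT (delta C T : R) z : R :=
  expR (C * (1 + T + sup_norm T z + Delta delta C T z)).

End SkorohodDefs.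

(* Main.v *)
Require Import Defs.
From mathcomp Require Import all_boot all_order all_algebra.
From mathcomp Require Import all_classical all_reals all_analysis.
From mathcomp Require Import ring lra.

Import Order.TTheory GRing.Theory Num.Theory.
Import numFieldNormedType.Exports.

Local Open Scope classical_set_scope.
Local Open Scope ring_scope.

(** The variation of [k] and its displacement control each other as long as [x]
    stays close to its starting point, and this feedback closes.

    Variation by displacement.  Near a point of the domain the translates
    [x + v + lam u], [|u| <= 1], stay in the domain.  Testing the variational
    inequality with them, [u] being the direction of an increment of [k], and
    summing over a partition gives, while [x] stays within [delta] of [x s],
      [sigma (V t - V s) <= |k t - k s| + (3 L + 4 rho) (t - s)],
    where [V] is the variation of [k] ([window_tvar]).

    Displacement by variation.  Testing with the constant path [x s], and using
    [d |k - k s|^2 = 2 <k - k s, dk>] together with [k - k s = (m - m s) - (x - x s)],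
    gives
      [|k t - k s|^2 <= 2 (L + L alpha) (t - s)
         + 2 alpha^2 (rho (t - s) + gamma (V t - V s)) + 2 om (V t - V s)],
    where [alpha] and [om] bound the oscillations of [x] and [m] from time [s]
    ([window_increment]).

    Insert the first inequality in the second.  If [x] stays within a radius [win]
    with [8 gamma win <= sigma], the terms that are quadratic in [k] on the right
    are absorbed on the left ([young_window]), so that [|k - k s|^2] and
    [|x - x s|^2] are at most a constant times [P mu_m(t - s)], where
    [P = 1 + T + |m|_T] ([window_mu]).  Therefore [x] cannot leave the window
    before a time [h] such that [P mu_m(h)] is small ([window_stay]).  The number
    [1 / Delta_m] is such a time, so [T Delta_m + 1] windows cover [[0, T]].  All
    bounds obtained this way are polynomial in [P + Delta_m], and
    [exp (C (P + Delta_m))] dominates them ([horizon_bounds]).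

    Stability.  Test the inequality for [x] with [hx] and the one for [hx] with
    [x]: in the sum the integrals of [phi] cancel ([difference_increment]).  Since
    [w = (k - hk) - (x0 - hx0)] equals [(m - hm) - (x - hx)], what is left is a
    Gronwall inequality for [|w|^2] with respect to a measure whose mass on [[0, T]]
    is at most a multiple of [C_{T,m} + C_{T,hm}] ([stieltjes_gronwall]).

    Stieltjes integrals enter only on short intervals [[a, b]], where
    [int_a^b <z, dk>] differs from [<z a, k b - k a>] by at most [d] times the
    oscillation of [z] times the variation of [k] ([stieltjes_dot_approx]);
    inequalities then propagate to long intervals by [chain_induction]. *)

(** * Euclidean inner product and norm *)

Section EuclideanNorm.
Local Set Implicit Arguments.
Local Unset Strict Implicit.
Context {R : realType} {d : nat}.
Implicit Types (u v w : 'rV[R]_d) (c : R).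

Lemma dotC u v : dot u v = dot v u.
Proof. by apply: eq_bigr => i _; rewrite mulrC. Qed.

Lemma dotDl u v w : dot (u + v) w = dot u w + dot v w.
Proof. by rewrite -big_split; apply: eq_bigr => i _; rewrite mxE mulrDl. Qed.

Lemma dotZl c u v : dot (c *: u) v = c * dot u v.
Proof. by rewrite mulr_sumr; apply: eq_bigr => i _; rewrite mxE mulrA. Qed.

Lemma dotNl u v : dot (- u) v = - dot u v.
Proof. by rewrite -scaleN1r dotZl mulN1r. Qed.

Lemma dotBl u v w : dot (u - v) w = dot u w - dot v w.
Proof. by rewrite dotDl dotNl. Qed.

Lemma dotDr u v w : dot u (v + w) = dot u v + dot u w.
Proof. by rewrite dotC dotDl !(dotC _ u). Qed.

Lemma dotNr u v : dot u (- v) = - dot u v.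
Proof. by rewrite dotC dotNl dotC. Qed.

Lemma dotBr u v w : dot u (v - w) = dot u v - dot u w.
Proof. by rewrite dotDr dotNr. Qed.

Lemma dotZr c u v : dot u (c *: v) = c * dot u v.
Proof. by rewrite dotC dotZl dotC. Qed.

Lemma dot_ge0 u : 0 <= dot u u.
Proof. by apply: sumr_ge0 => i _; exact: sqr_ge0. Qed.

Lemma enorm_ge0 u : 0 <= enorm u.
Proof. exact: sqrtr_ge0. Qed.

Lemma enorm_sqr u : enorm u ^+ 2 = dot u u.
Proof. by rewrite sqr_sqrtr ?dot_ge0. Qed.

Lemma dot0l u : dot 0 u = 0.
Proof. by rewrite -(scale0r 0) dotZl mul0r. Qed.

Lemma enorm0 : enorm (0 : 'rV[R]_d) = 0.
Proof. by rewrite /enorm dot0l sqrtr0. Qed.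

Lemma enormN u : enorm (- u) = enorm u.
Proof. by rewrite /enorm dotNl dotNr opprK. Qed.

Lemma enormZ c u : enorm (c *: u) = `|c| * enorm u.
Proof.
by rewrite /enorm dotZl dotZr mulrA -expr2 sqrtrM ?sqr_ge0// sqrtr_sqr.
Qed.

Lemma enormB u v : enorm (u - v) = enorm (v - u).
Proof. by rewrite -enormN opprB. Qed.

Lemma coord_le_enorm u i : `|u 0 i| <= enorm u.
Proof.
rewrite -sqrtr_sqr ler_wsqrtr// /dot (bigD1 i)//= -expr2 lerDl.
by apply: sumr_ge0 => j _; exact: sqr_ge0.
Qed.

Lemma enorm_eq0 u : enorm u = 0 -> u = 0.
Proof.
move=> u0; apply/rowP => i; rewrite mxE; apply/eqP.
by rewrite -normr_le0 -u0 coord_le_enorm.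
Qed.

Lemma cauchy_schwarz u v : dot u v <= enorm u * enorm v.
Proof.
have [->|u0] := eqVneq u 0; first by rewrite dot0l enorm0 mul0r.
have [->|v0] := eqVneq v 0; first by rewrite dotC dot0l enorm0 mulr0.
have nu : 0 < enorm u.
  by rewrite lt_neqAle enorm_ge0 andbT eq_sym; apply: contra_neq u0; exact: enorm_eq0.
have nv : 0 < enorm v.
  by rewrite lt_neqAle enorm_ge0 andbT eq_sym; apply: contra_neq v0; exact: enorm_eq0.
have := dot_ge0 (enorm v *: u - enorm u *: v).
rewrite dotBl !dotBr !dotZl !dotZr -!enorm_sqr (dotC v u) => H.
have {}H : 0 <= 2 * (enorm u * enorm v) * (enorm u * enorm v - dot u v) by lra.
by rewrite pmulr_rge0 ?mulr_gt0// subr_ge0 in H.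
Qed.

Lemma enormD_sqr u v :
  enorm (u + v) ^+ 2 = enorm u ^+ 2 + 2 * dot u v + enorm v ^+ 2.
Proof. by rewrite !enorm_sqr dotDl !dotDr (dotC v u); ring. Qed.

Lemma enormB_sqr_le u v :
  enorm (u - v) ^+ 2 <= 2 * enorm u ^+ 2 + 2 * enorm v ^+ 2.
Proof.
have := sqr_ge0 (enorm (u + v)).
by rewrite (enormD_sqr u v) (enormD_sqr u (- v)) enormN dotNr; lra.
Qed.

Lemma enormD u v : enorm (u + v) <= enorm u + enorm v.
Proof.
rewrite -ler_sqr ?nnegrE ?addr_ge0 ?enorm_ge0// enormD_sqr.
by rewrite sqrrD; have := cauchy_schwarz u v; lra.
Qed.

Lemma enorm_triangle w u v : enorm (u - v) <= enorm (u - w) + enorm (w - v).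
Proof. by rewrite -[u - v](subrKA w) enormD. Qed.

Lemma enorm_dist u v : enorm u - enorm v <= enorm (u - v).
Proof. by rewrite lerBlDr -{1}(subrK v u) enormD. Qed.

(** The topology of row vectors is that of the max norm; this is the comparison
    that carries neighbourhoods over to the Euclidean norm. *)
Lemma enorm_le_max u (c : R) : (forall i, `|u 0 i| <= c) -> enorm u <= d%:R * c.
Proof.
move=> uc; have [d0|d0] := posnP d.
  have -> : u = 0 by apply/rowP => i; have := ltn_ord i; rewrite [X in (_ < X)%N]d0.
  by rewrite enorm0 d0 mul0r.
have c0 : 0 <= c by apply: le_trans (uc (Ordinal d0)).
rewrite -ler_sqr ?nnegrE ?enorm_ge0 ?mulr_ge0// enorm_sqr.
apply: (@le_trans _ _ (\sum_(i < d) c ^+ 2)).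
  apply: ler_sum => i _; rewrite -expr2 -real_normK ?num_real//.
  by rewrite ler_sqr ?nnegrE.
rewrite sumr_const card_ord -[X in X <= _]mulr_natl exprMn ler_wpM2r ?sqr_ge0//.
by rewrite expr2 ler_peMl// ler1n.
Qed.

End EuclideanNorm.

(** * Induction along a segment and uniform oscillation *)

Section RealInduction.
Local Set Implicit Arguments.
Local Unset Strict Implicit.
Context {R : realType}.

(** Lets discretization errors of the form [e * c] vanish. *)
Lemma le_of_small (a b c : R) : 0 <= c -> (forall e, 0 < e -> a <= b + e * c) -> a <= b.
Proof.
move=> c0 H; apply/ler_addgt0Pr => e e0.
apply: le_trans (H (e / (c + 1)) _) _; first by rewrite divr_gt0//; lra.
rewrite lerD2l -mulrA ger_pMr// mulrC ler_pdivrMr//; lra.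
Qed.

(** The supremum of the points of the segment where [P] holds is reached and
    passed, because [P] propagates in a neighbourhood of that supremum. *)
Lemma real_induction (s t : R) (P : R -> Prop) : s <= t -> P s ->
  (forall r, s <= r <= t -> exists2 eta, 0 < eta &
     forall a b, s <= a -> a <= b -> b <= t ->
       r - eta < a -> b < r + eta -> P a -> P b) ->
  P t.
Proof.
move=> st Ps step; pose S := [set r | s <= r <= t /\ P r].
have Ss : S s by split => //; rewrite lexx.
have Sub : has_ubound S by exists t => r [/andP[]].
have S0 : S !=set0 by exists s.
have supS : has_sup S by split.
have rs : s <= sup S by exact: ub_le_sup.
have rt : sup S <= t by apply: ge_sup => // r [/andP[]].
have [|eta eta0 loc] := step (sup S); first by rewrite rs.
have [a [/andP[sa at_] Pa] ra] := sup_adherent eta0 supS.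
have ar : a <= sup S by apply: ub_le_sup => //; split => //; rewrite sa.
pose b := Num.min t (sup S + eta / 2).
have hb : a <= b by rewrite /b le_min at_/=; lra.
have Pb : P b.
  apply: (loc a) => //; rewrite /b; first by rewrite ge_min lexx.
  by rewrite gt_min; apply/orP; right; lra.
have : b <= sup S.
  apply: ub_le_sup => //; split => //; rewrite (le_trans sa hb)/=.
  by rewrite /b ge_min lexx.
rewrite /b ge_min => /orP[ts|]; last by lra.
by move: Pb; rewrite /b min_l//; lra.
Qed.

(** Used to pass from inequalities on intervals shorter than [eta] to the whole
    segment. *)
Lemma chain_induction (s t eta : R) (P : R -> Prop) : s <= t -> 0 < eta ->
  (forall a b, s <= a -> a <= b -> b <= t -> b - a < eta -> P a -> P b) ->
  P s -> P t.
Proof.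
move=> st eta0 step Ps; apply: (real_induction st Ps) => r _.
exists (eta / 2); first by lra.
by move=> a b sa ab bt ra br; apply: step => //; lra.
Qed.

(** [D p q] stands for [`|g p - g q|] or [enorm (z p - z q)]: uniform continuity of
    scalar and of vector functions is treated at once. *)
Definition uosc (s t : R) (D : R -> R -> R) := forall e : R, 0 < e ->
  exists2 eta : R, 0 < eta & forall p q, s <= p <= t -> s <= q <= t ->
    `|p - q| < eta -> D p q < e.

(** Uniform continuity up to time [r] extends a little beyond [r]: of two close
    points, either both lie before [r] or both lie in the neighbourhood of [r] where
    [D] is small. *)
Lemma heine (s t : R) (D : R -> R -> R) : s <= t ->
  (forall p, D p p = 0) -> (forall p q, D p q = D q p) ->
  (forall r p q, D p q <= D p r + D r q) ->
  (forall r, s <= r <= t -> forall e : R, 0 < e -> exists2 eta : R, 0 < eta &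
     forall p, s <= p <= t -> `|p - r| < eta -> D p r < e) ->
  uosc s t D.
Proof.
move=> st D0 DC Dtri loc e e0.
pose P r := exists2 eta : R, 0 < eta & forall p q, s <= p <= r -> s <= q <= r ->
    `|p - q| < eta -> D p q < e.
apply: (@real_induction s t P st).
  exists 1 => // p q ps qs _.
  have -> : p = s by apply/eqP; rewrite eq_le andbC.
  have -> : q = s by apply/eqP; rewrite eq_le andbC.
  by rewrite D0.
move=> r rst; have [eta eta0 near_r] := loc r rst (e / 2) ltac:(lra).
have half : forall p q, s <= p <= t -> s <= q <= t ->
    `|p - r| < eta -> `|q - r| < eta -> D p q < e.
  move=> p q ps qs pr qr; have := Dtri r p q; rewrite (DC r).
  by have := near_r p ps pr; have := near_r q qs qr; lra.
exists (eta / 2); first by lra.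
move=> a b sa ab bt ra br [eta' eta'0 IH].
exists (Num.min eta' (eta / 2)); first by rewrite lt_min eta'0; lra.
move=> p q /andP[sp pb] /andP[sq qb]; rewrite lt_min => /andP[pq1 pq2].
have [pa|pa] := lerP p a; have [qa|qa] := lerP q a.
- by apply: IH => //; apply/andP.
- apply: half; [lra|lra| |rewrite ltr_norml; lra].
  by move: pq2; rewrite !ltr_norml; lra.
- apply: half; [lra|lra|rewrite ltr_norml; lra|].
  by move: pq2; rewrite !ltr_norml; lra.
- by apply: half; [lra|lra|rewrite ltr_norml; lra|rewrite ltr_norml; lra].
Qed.

Lemma uosc_le (s t c : R) (D1 D2 D : R -> R -> R) : 0 <= c ->
  uosc s t D1 -> uosc s t D2 ->
  (forall p q, s <= p <= t -> s <= q <= t -> D p q <= c * (D1 p q + D2 p q)) ->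
  uosc s t D.
Proof.
move=> c0 u1 u2 DD e e0; have e'0 : 0 < e / (2 * (c + 1)) by rewrite divr_gt0//; lra.
have [h1 h10 H1] := u1 _ e'0; have [h2 h20 H2] := u2 _ e'0.
exists (Num.min h1 h2); first by rewrite lt_min h10.
move=> p q ps qs; rewrite lt_min => /andP[p1 p2].
apply: le_lt_trans (DD p q ps qs) _.
have l1 := H1 p q ps qs p1; have l2 := H2 p q ps qs p2.
have ee : e = (c + 1) * (2 * (e / (2 * (c + 1)))) by field; lra.
apply: (@le_lt_trans _ _ (c * (2 * (e / (2 * (c + 1)))))); first by rewrite ler_wpM2l//; lra.
by rewrite [ltRHS]ee ltr_pM2r; lra.
Qed.

End RealInduction.

(** * Continuous paths *)

Section ContinuousPaths.
Local Set Implicit Arguments.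
Local Unset Strict Implicit.
Context {R : realType} {d : nat}.
Implicit Types z : R -> 'rV[R]_d.

Lemma uosc_path z (s t : R) : continuous_Rplus z -> 0 <= s -> s <= t ->
  uosc s t (fun p q => enorm (z p - z q)).
Proof.
move=> cz s0 st; apply: heine => //.
- by move=> p; rewrite subrr enorm0.
- by move=> p q; rewrite enormB.
- by move=> r p q; exact: enorm_triangle.
move=> r rst e e0.
have r0 : 0 <= r by lra.
have d0 : 0 < d%:R + 1 :> R by rewrite ltr_wpDl.
have : \forall p \near within `[0, +oo[%classic (nbhs r),
    ball (z r) (e / (d%:R + 1)) (z p).
  move/subspace_continuousP : cz => /(_ r); rewrite /= in_itv/= andbT => /(_ r0).
  by move=> /cvg_ballP; apply; rewrite divr_gt0.
rewrite /= near_withinE => /nbhs_ballP[eta /= eta0 H].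
exists eta => // p pst pr.
have := H p; rewrite /ball/= distrC => /(_ pr); rewrite in_itv/= andbT.
move=> /(_ ltac:(lra)) [_ zz].
apply: (@le_lt_trans _ _ (d%:R * (e / (d%:R + 1)))).
  apply: enorm_le_max => i; rewrite !mxE distrC ltW//.
  by have := zz 0 i.
by rewrite mulrCA gtr_pMr// ltr_pdivrMr// mul1r ltrDl.
Qed.

Lemma bounded_path z (T : R) : continuous_Rplus z -> 0 <= T ->
  exists B, forall r, 0 <= r <= T -> enorm (z r) <= B.
Proof.
move=> cz T0; have [eta eta0 H] := uosc_path cz (lexx 0) T0 ltr01.
pose P t := exists B, forall r, 0 <= r <= t -> enorm (z r) <= B.
apply: (@chain_induction _ 0 T eta P) => //.
  move=> a b a0 ab bT ba [B HB]; exists (B + 1) => r /andP[r0 rb].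
  have [ra|ra] := lerP r a.
    by have := HB r; rewrite r0 ra => /(_ isT); lra.
  have := HB a; rewrite a0 lexx => /(_ isT).
  have := H r a ltac:(lra) ltac:(lra); rewrite ltr_norml => /(_ ltac:(lra)).
  by have := enorm_dist (z r) (z a); lra.
exists (enorm (z 0)) => r /andP[r0 r1].
by have -> : r = 0 by apply/eqP; rewrite eq_le r0 r1.
Qed.

Lemma sup_norm_ge z (T r : R) : continuous_Rplus z -> 0 <= r <= T ->
  enorm (z r) <= sup_norm T z.
Proof.
move=> cz rT; have [B HB] := @bounded_path z T cz ltac:(lra).
apply: ub_le_sup; last by exists r => //; rewrite /= in_itv/=.
by exists B => _ [q /= qT <-]; apply: HB; rewrite in_itv/= in qT.
Qed.

Lemma sup_norm_le z (T B : R) : 0 <= T ->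
  (forall r, 0 <= r <= T -> enorm (z r) <= B) -> sup_norm T z <= B.
Proof.
move=> T0 HB; apply: ge_sup.
  by exists (enorm (z 0)), 0 => //; rewrite /= in_itv/= lexx.
by move=> _ [q /= qT <-]; apply: HB; rewrite in_itv/= in qT.
Qed.

Lemma continuous_RplusD z1 z2 : continuous_Rplus z1 -> continuous_Rplus z2 ->
  continuous_Rplus (fun r => z1 r + z2 r).
Proof. by move=> c1 c2 r; apply: cvgD; [exact: c1|exact: c2]. Qed.

Lemma continuous_RplusN z : continuous_Rplus z -> continuous_Rplus (fun r => - z r).
Proof. by move=> c r; apply: cvgN; exact: c. Qed.

Lemma continuous_Rplus_cst (u : 'rV[R]_d) : continuous_Rplus (fun=> u : 'rV[R]_d).
Proof. by move=> r; exact: cvg_cst. Qed.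

End ContinuousPaths.

(** * Riemann-Stieltjes integrals *)

Section StieltjesIntegral.
Local Set Implicit Arguments.
Local Unset Strict Implicit.
Context {R : realType}.
Implicit Types (g h W J F : R -> R) (a b : R).

Lemma fine_partition a b (eta : R) : a <= b -> 0 < eta ->
  exists2 s, itv_partition a b s & forall i, (i < size s)%N ->
    let p := nth b (a :: s) in p i.+1 - p i < eta.
Proof.
move=> ab eta0; pose e := fun u v : R => (u < v) && (v - u < eta).
pose P r := exists2 s, path e a s & last a s = r.
have [s es lasts] : P b.
  apply: (chain_induction (P := P) ab eta0); last by exists [::].
  move=> u v au; rewrite le_eqVlt => /predU1P[->//|uv] vb vu [s es su].
  exists (rcons s v); last by rewrite last_rcons.
  by rewrite rcons_path es su /e uv vu.
exists s; last first.
  by move=> i si; have /(pathP b)/(_ i si)/andP[] := es.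
split; last by rewrite lasts.
by apply: sub_path es => u v /andP[].
Qed.

Lemma telescope_partition F a b s (p := nth b (a :: s)) : itv_partition a b s ->
  \sum_(0 <= i < size s) (F (p i.+1) - F (p i)) = F b - F a.
Proof.
move=> abs; rewrite (telescope_sumr (F \o p)) //= /p.
by rewrite (itv_partition_nth_size _ abs).
Qed.

Lemma partition_bounds a b s i (p := nth b (a :: s)) : itv_partition a b s ->
  (i < size s)%N -> [/\ a <= p i, p i <= p i.+1 & p i.+1 <= b].
Proof.
move=> abs si; split.
- by apply: itv_partition_nth_ge abs; rewrite ltnS ltnW.
- by case: (abs) => /(pathP b)/(_ i si)/ltW.
- by apply: itv_partition_nth_le abs; rewrite ltnS.
Qed.

(** [J] is the least function whose increments dominate [c * (h q - h p)] for every
    lower bound [c] of [g] on [[p, q]], that is, the lower Darboux integral of [g]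
    with respect to [h].  Minimality gives the upper bound: following a competitor
    up to [p] and [c * h] afterwards produces another competitor. *)
Lemma stieltjes_indefinite g h a b (B : R) : a <= b ->
  (forall p q, a <= p -> p <= q -> q <= b -> h p <= h q) ->
  (forall r, a <= r <= b -> `|g r| <= B) ->
  exists J : R -> R, forall p q, a <= p -> p <= q -> q <= b -> forall c,
    ((forall r, p <= r <= q -> c <= g r) -> c * (h q - h p) <= J q - J p) /\
    ((forall r, p <= r <= q -> g r <= c) -> J q - J p <= c * (h q - h p)).
Proof.
move=> ab hmono gB.
pose feas v (Th : R -> R) := Th a = 0 /\ forall p q c,
  a <= p -> p <= q -> q <= v -> (forall r, p <= r <= q -> c <= g r) ->
  c * (h q - h p) <= Th q - Th p.
pose S v := [set Th v | Th in feas v].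
have S0 v : a <= v -> v <= b -> S v !=set0.
  move=> av vb; exists (B * (h v - h a)), (fun r => B * (h r - h a)) => //.
  split; first by rewrite subrr mulr0.
  move=> p q c ap pq qv cg; rewrite -mulrBr opprB addrA subrK ler_wpM2r//.
    by rewrite subr_ge0 hmono//; lra.
  apply: le_trans (cg p _) _; first by rewrite lexx.
  by apply: le_trans (ler_norm _) _; apply: gB; lra.
have Slb v : a <= v -> v <= b -> has_lbound (S v).
  move=> av vb; exists (- B * (h v - h a)) => _ [Th [Th0 HTh] <-].
  rewrite -[leRHS]subr0 -Th0; apply: HTh => // r ravb.
  by have := gB r ltac:(lra); rewrite ler_norml => /andP[].
exists (fun v => inf (S v)) => p q ap pq qb c; split => cg.
  rewrite lerBrDr; apply: lb_le_inf; first by apply: S0 => //; lra.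
  move=> _ [Th [Th0 HTh] <-].
  have : inf (S p) <= Th p.
    apply: ge_inf; first by apply: Slb; lra.
    exists Th => //; split => // p' q' c' ap' pq' qp'; apply: HTh => //; lra.
  by have := HTh p q c ap pq (lexx q) cg; lra.
move: pq; rewrite le_eqVlt => /predU1P[<-|pq]; first by rewrite !subrr mulr0.
rewrite lerBlDr -lerBlDl; apply: lb_le_inf; first by apply: S0 => //; lra.
move=> _ [Th [Th0 HTh] <-].
pose Th' r := if r <= p then Th r else Th p + c * (h r - h p).
have -> : Th p = Th' q - c * (h q - h p) by rewrite /Th' leNgt pq/=; lra.
rewrite lerD2r; apply: ge_inf; first by apply: Slb; lra.
exists Th' => //; split; first by rewrite /Th' ap.
move=> u v c' au uv vq c'g; rewrite /Th'.
have [vp|vp] := lerP v p; first by rewrite (le_trans uv vp); exact: HTh.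
have [up|up] := lerP u p.
  have l1 : c' * (h p - h u) <= Th p - Th u.
    by apply: HTh => // r rup; apply: c'g; lra.
  have l2 : c' * (h v - h p) <= c * (h v - h p).
    rewrite ler_wpM2r ?subr_ge0 ?hmono//; try lra.
    by apply: le_trans (c'g p _) (cg p _); lra.
  lra.
rewrite opprD addrACA subrr add0r -mulrBr opprB addrA subrK.
rewrite ler_wpM2r ?subr_ge0 ?hmono//; try lra.
by apply: le_trans (c'g u _) (cg u _); lra.
Qed.

Lemma uosc_bounded g a b : a <= b -> uosc a b (fun p q => `|g p - g q|) ->
  exists B, forall r, a <= r <= b -> `|g r| <= B.
Proof.
move=> ab ug; have [eta eta0 H] := ug 1 ltr01.
pose P t := exists B, forall r, a <= r <= t -> `|g r| <= B.
apply: (@chain_induction _ a b eta P) => //.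
  move=> u v au uv vb vu [B HB]; exists (B + 1) => r /andP[ar rv].
  have [ru|ru] := lerP r u; first by have := HB r; rewrite ar ru => /(_ isT); lra.
  have := HB u; rewrite au lexx => /(_ isT).
  have := H r u ltac:(lra) ltac:(lra); rewrite ltr_norml => /(_ ltac:(lra)).
  by have := lerB_dist (g r) (g u); lra.
exists `|g a| => r /andP[r0 r1].
by have -> : r = a by apply/eqP; rewrite eq_le r0 r1.
Qed.

(** [h] is the difference of the nondecreasing functions [W + h] and [W]. On an
    interval where [g] varies by less than [e'], the increment of each indefinite
    integral is known up to [e'] times the increment of the integrator, so all fine
    Riemann sums are close to the increment of the difference. *)
Lemma stieltjes_exists g h W a b : a <= b ->
  uosc a b (fun p q => `|g p - g q|) ->
  (forall p q, a <= p -> p <= q -> q <= b -> `|h q - h p| <= W q - W p) ->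
  is_stieltjes_int g h a b (stieltjes_int g h a b).
Proof.
move=> ab ug hW; rewrite /stieltjes_int; apply: xgetPex.
have [B gB] := uosc_bounded ab ug.
have [|J1 HJ1] := @stieltjes_indefinite g (fun r => W r + h r) a b B ab _ gB.
  by move=> p q ap pq qb; have := hW p q ap pq qb; rewrite ler_norml; lra.
have [|J2 HJ2] := @stieltjes_indefinite g W a b B ab _ gB.
  by move=> p q ap pq qb; have := hW p q ap pq qb; rewrite ler_norml; lra.
pose J r := J1 r - J2 r.
exists (J b - J a) => e e0.
have WW : 0 <= W b - W a by apply: le_trans (hW a b _ _ _).
have [|eta eta0 H] := ug (e / (3 * (W b - W a) + 1)); first by rewrite divr_gt0//; lra.
set e' := e / _ in H; exists eta => // s xi p abs fine_s.
rewrite -(telescope_partition J abs) -/p -sumrB.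
apply: (@le_lt_trans _ _ (\sum_(0 <= i < size s) (3 * e' * (W (p i.+1) - W (p i))))).
  apply: le_trans (ler_norm_sum _ _ _) _.
  rewrite big_nat [leRHS]big_nat; apply: ler_sum => i /andP[_ si].
  have [ai ii ib] := partition_bounds abs si.
  have [mesh /andP[xl xr]] := fine_s i si.
  have near_xi r : p i <= r <= p i.+1 -> `|g r - g (xi i)| < e'.
    by move=> rp; apply: H; rewrite ?ltr_norml; move: mesh ai ib; rewrite -/p; lra.
  have lo r : p i <= r <= p i.+1 -> g (xi i) - e' <= g r.
    by move=> /near_xi; rewrite ltr_norml; lra.
  have up r : p i <= r <= p i.+1 -> g r <= g (xi i) + e'.
    by move=> /near_xi; rewrite ltr_norml; lra.
  have := (HJ1 _ _ ai ii ib (g (xi i) - e')).1 lo.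
  have := (HJ2 _ _ ai ii ib (g (xi i) - e')).1 lo.
  have := (HJ1 _ _ ai ii ib (g (xi i) + e')).2 up.
  have := (HJ2 _ _ ai ii ib (g (xi i) + e')).2 up.
  have e'0 : 0 <= e' by have := near_xi _ (introT andP (conj xl xr)); rewrite subrr normr0 => /ltW.
  have := hW _ _ ai ii ib; rewrite -/p /J !ler_norml => /andP[].
  set dW := W _ - _; set G := g _.
  have -> : W (p i.+1) + h (p i.+1) - (W (p i) + h (p i)) = dW + (h (p i.+1) - h (p i)) by rewrite /dW; ring.
  set dh := h _ - _.
  set j1 := J1 (p i.+1); set j2 := J2 (p i.+1); set i1 := J1 (p i); set i2 := J2 (p i).
  move=> dh1 dh2 ? ? ? ?.
  have : e' * dh <= e' * dW by rewrite ler_wpM2l.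
  have : - (e' * dW) <= e' * dh by rewrite -mulrN ler_wpM2l.
  by move=> *; apply/andP; split; lra.
rewrite -mulr_sumr telescope_partition//.
have ee : e = e' * (3 * (W b - W a) + 1) by rewrite /e'; field; lra.
have e'0 : 0 < e' by rewrite /e' divr_gt0//; lra.
by rewrite [ltRHS]ee; lra.
Qed.

Lemma stieltjes_approx g h W a b (e : R) : a <= b ->
  uosc a b (fun p q => `|g p - g q|) ->
  (forall p q, a <= p -> p <= q -> q <= b -> `|h q - h p| <= W q - W p) ->
  (forall r, a <= r <= b -> `|g r - g a| <= e) ->
  `|stieltjes_int g h a b - g a * (h b - h a)| <= e * (W b - W a).
Proof.
move=> ab ug hW ge; apply/ler_addgt0Pr => e' e'0.
have [eta eta0 H] := stieltjes_exists ab ug hW e'0.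
have [s abs mesh] := fine_partition ab eta0.
set p := nth b (a :: s) in mesh.
have := H s p abs _; rewrite -/p => /(_ _)/ltW.
set I := stieltjes_int _ _ _ _; set S := \sum_(0 <= _ < _) _ => HS.
have {}HS : `|S - I| <= e'.
  apply: HS => i si; split; first exact: mesh.
  by have [_ -> _] := partition_bounds abs si; rewrite lexx.
have : `|S - g a * (h b - h a)| <= e * (W b - W a).
  rewrite -(telescope_partition h abs) -(telescope_partition W abs) -/p.
  rewrite !mulr_sumr -sumrB; apply: le_trans (ler_norm_sum _ _ _) _.
  rewrite big_nat [leRHS]big_nat; apply: ler_sum => i /andP[_ si].
  have [ai ii ib] := partition_bounds abs si.
  rewrite -mulrBl normrM ler_pM//; last exact: hW.
  by apply: ge; rewrite ai (le_trans ii ib).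
move: HS; rewrite !ler_norml => /andP[? ?] /andP[? ?]; apply/andP; split; lra.
Qed.

Lemma stieltjes_dot_approx {d} (z k : R -> 'rV[R]_d) W a b (e : R) : a <= b ->
  uosc a b (fun p q => enorm (z p - z q)) ->
  (forall p q, a <= p -> p <= q -> q <= b -> enorm (k q - k p) <= W q - W p) ->
  (forall r, a <= r <= b -> enorm (z r - z a) <= e) ->
  `|stieltjes_dot z k a b - dot (z a) (k b - k a)| <= d%:R * e * (W b - W a).
Proof.
move=> ab uz kW ze; rewrite /stieltjes_dot /dot -sumrB.
apply: le_trans (ler_norm_sum _ _ _) _.
apply: (@le_trans _ _ (\sum_(i < d) (e * (W b - W a)))); last first.
  by rewrite sumr_const card_ord -mulrA mulr_natl.
apply: ler_sum => i _; rewrite !mxE.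
have coordB (f : R -> 'rV[R]_d) p q : `|f p 0 i - f q 0 i| <= enorm (f p - f q).
  by have := coord_le_enorm (f p - f q) i; rewrite !mxE.
apply: (@stieltjes_approx _ (fun r => k r 0 i)) => //.
- apply: (uosc_le ler01 uz uz) => p q ps qs.
  by apply: le_trans (coordB z p q) _; have := enorm_ge0 (z p - z q); lra.
- by move=> p q ap pq qb; apply: le_trans (coordB k q p) (kW _ _ _ _ _).
- by move=> r ar; apply: le_trans (coordB z r a) (ze _ ar).
Qed.

End StieltjesIntegral.

(** * Total variation of a path *)

Section TotalVariation.
Local Set Implicit Arguments.
Local Unset Strict Implicit.
Context {R : realType} {d : nat}.
Variable k : R -> 'rV[R]_d.
Hypothesis k_bv : forall t, 0 <= t -> (tvar k t < +oo)%E.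

Let V t := fine (tvar k t).

Lemma variation_rcons (p q : R) s : itv_partition 0 p s ->
  variation_on k 0 q (rcons s q) = variation_on k 0 p s + enorm (k q - k p).
Proof.
move=> ps; rewrite /variation_on size_rcons big_nat_recr//=; congr (_ + _).
  rewrite big_nat [RHS]big_nat; apply: eq_bigr => i /andP[_ si].
  have E j : (j <= size s)%N -> nth q (0 :: rcons s q) j = nth p (0 :: s) j.
    move=> js; rewrite -rcons_cons nth_rcons/= ltnS js.
    by apply: set_nth_default; rewrite /= ltnS.
  by have := E i.+1 si; have := E i (ltnW si) => /= -> ->.
rewrite nth_rcons ltnn eqxx -rcons_cons nth_rcons/= ltnSn.
congr (enorm (_ - k _)).
by rewrite (itv_partition_nth_size _ ps).
Qed.

Lemma tvar_fin t : 0 <= t -> tvar k t \is a fin_num.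
Proof.
move=> t0; apply: fin_real; rewrite k_bv// andbT.
have [->|t_gt0] := eqVneq t 0.
  apply: (@lt_le_trans _ _ (variation_on k 0 0 [::])%:E); first by rewrite ltNyr.
  by apply: ereal_sup_ubound; exists [::] => //; split => /=.
apply: (@lt_le_trans _ _ (variation_on k 0 t [:: t])%:E); first by rewrite ltNyr.
apply: ereal_sup_ubound; exists [:: t] => //; apply: itv_partition1.
by rewrite lt_def t_gt0.
Qed.

Lemma variation_le t s : 0 <= t -> itv_partition 0 t s ->
  variation_on k 0 t s <= V t.
Proof.
move=> t0 ts; rewrite -lee_fin fineK ?tvar_fin//.
by apply: ereal_sup_ubound; exists s.
Qed.

Lemma tvar_le t (B : R) : 0 <= t ->
  (forall s, itv_partition 0 t s -> variation_on k 0 t s <= B) -> V t <= B.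
Proof.
move=> t0 H; rewrite -lee_fin fineK ?tvar_fin//.
by apply: ge_ereal_sup => _ [s /= ts <-]; rewrite lee_fin H.
Qed.

Lemma tvar_increment p q : 0 <= p -> p <= q -> enorm (k q - k p) <= V q - V p.
Proof.
move=> p0; rewrite le_eqVlt => /predU1P[<-|pq].
  by rewrite !subrr enorm0.
rewrite lerBrDr -lerBrDl; apply: tvar_le => // s ps.
rewrite lerBrDr -(variation_rcons q ps); apply: variation_le; first lra.
rewrite -cats1; apply: itv_partition_cat ps _; exact: itv_partition1.
Qed.

Lemma variation_telescope (Th : R -> R) t s :
  (forall p q, 0 <= p -> p <= q -> q <= t -> enorm (k q - k p) <= Th q - Th p) ->
  itv_partition 0 t s -> variation_on k 0 t s <= Th t - Th 0.
Proof.
move=> kTh ts; rewrite -(telescope_partition Th ts) /variation_on.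
rewrite big_nat [leRHS]big_nat; apply: ler_sum => i /andP[_ si].
by have [? ? ?] := partition_bounds ts si; exact: kTh.
Qed.

Lemma tvar0 : V 0 = 0.
Proof.
apply/eqP; rewrite eq_le; apply/andP; split.
  by apply: tvar_le => // s /itv_partitionxx ->; rewrite /variation_on big_nil.
have := @variation_le 0 [::] (lexx 0).
by rewrite /variation_on big_nil; apply; split => /=.
Qed.

(** The variation is the least function that dominates the increments of [k].
    Prolonging [V] beyond [s] by the increments of [Th] dominates the increments of
    [k] on all of [[0, t]], also across [s], by the triangle inequality. *)
Lemma tvar_least (Th : R -> R) s t : 0 <= s -> s <= t ->
  (forall p q, s <= p -> p <= q -> q <= t -> enorm (k q - k p) <= Th q - Th p) ->
  V t - V s <= Th t - Th s.
Proof.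
move=> s0 st kTh.
pose Th' r := if r <= s then V r else V s + (Th r - Th s).
suff : V t <= Th' t - Th' 0.
  rewrite /Th' s0 tvar0 subr0; have [ts|ts] := lerP t s; last by lra.
  by have -> : t = s by [apply/eqP; rewrite eq_le ts st]; lra.
apply: tvar_le => [|p]; first by lra.
apply: variation_telescope => u v u0 uv vt; rewrite /Th'.
have [vs|vs] := lerP v s; first by rewrite (le_trans uv vs) tvar_increment.
have [us|us] := lerP u s; last by have := kTh u v (ltW us) uv vt; lra.
have := enorm_triangle (k s) (k v) (k u).
have := tvar_increment u0 us; have := kTh s v (lexx s) (ltW vs) vt; lra.
Qed.

Lemma tvar_mono p q : 0 <= p -> p <= q -> V p <= V q.
Proof.
by move=> p0 pq; have := tvar_increment p0 pq; have := enorm_ge0 (k q - k p); lra.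
Qed.

End TotalVariation.

(** * The modulus of continuity and its inverse *)

Section Modulus.
Local Set Implicit Arguments.
Local Unset Strict Implicit.
Context {R : realType} {d : nat} {z : R -> 'rV[R]_d} {T : R}.
Hypotheses (z_cont : continuous_Rplus z) (T_gt0 : 0 < T).

Let T_ge0 : 0 <= T. Proof. exact: ltW. Qed.

Lemma sup_norm_ge0 : 0 <= sup_norm T z.
Proof.
apply: le_trans (enorm_ge0 (z 0)) _; apply: sup_norm_ge => //.
by rewrite lexx.
Qed.

Lemma modulus_ge p q e : 0 <= p <= T -> 0 <= q <= T -> `|p - q| <= e ->
  enorm (z p - z q) <= modulus T z e.
Proof.
move=> pT qT pq; apply: ub_le_sup; last by exists p, q; rewrite !in_itv.
exists (2 * sup_norm T z) => _ [t [s [tT sT _ ->]]].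
rewrite !in_itv/= in tT sT.
have := sup_norm_ge z_cont tT; have := sup_norm_ge z_cont sT.
by have := enormD (z t) (- z s); rewrite enormN; lra.
Qed.

Lemma modulus_le e (B : R) : 0 <= e ->
  (forall p q, 0 <= p -> p <= q -> q <= T -> q - p <= e -> enorm (z q - z p) <= B) ->
  modulus T z e <= B.
Proof.
move=> e0 HB; apply: ge_sup.
  by exists (enorm (z 0 - z 0)), 0, 0; rewrite subrr normr0 in_itv/= lexx T_ge0.
move=> _ [t [s [tT sT ts ->]]]; rewrite !in_itv/= in tT sT.
move: ts; rewrite ler_norml; have [st|st] := lerP s t; move=> ts.
  by apply: HB; lra.
by rewrite enormB; apply: HB; lra.
Qed.

Lemma modulus_ge0 e : 0 <= e -> 0 <= modulus T z e.
Proof.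
move=> e0; apply: le_trans (enorm_ge0 (z 0 - z 0)) _.
by apply: modulus_ge; rewrite ?lexx// subrr normr0.
Qed.

Lemma modulus_le_sup e : 0 <= e -> modulus T z e <= 2 * sup_norm T z.
Proof.
move=> e0; apply: modulus_le => // p q p0 pq qT _.
have := @sup_norm_ge _ _ z T p z_cont ltac:(lra).
have := @sup_norm_ge _ _ z T q z_cont ltac:(lra).
by have := enormD (z q) (- z p); rewrite enormN; lra.
Qed.

Lemma modulus_mono e e' : 0 <= e -> e <= e' -> modulus T z e <= modulus T z e'.
Proof.
move=> e0 ee'; apply: modulus_le => // p q p0 pq qT qp.
by apply: modulus_ge; rewrite ?ger0_norm; lra.
Qed.

Lemma modulus_subadd e e' : 0 <= e -> 0 <= e' ->
  modulus T z (e + e') <= modulus T z e + modulus T z e'.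
Proof.
move=> e0 e'0; apply: modulus_le; first by lra.
move=> p q p0 pq qT qp.
pose r := Num.min q (p + e).
have pr : p <= r by rewrite /r le_min pq; lra.
have rq : r <= q by rewrite /r ge_min lexx.
have rp : r <= p + e by rewrite /r ge_min lexx orbT.
have qr : q - r <= e' by rewrite /r minEle; case: ifP => ?; lra.
have : enorm (z q - z r) <= modulus T z e' by apply: modulus_ge; rewrite ?ger0_norm; lra.
have : enorm (z r - z p) <= modulus T z e by apply: modulus_ge; rewrite ?ger0_norm; lra.
by have := enorm_triangle (z r) (z q) (z p); lra.
Qed.

Lemma mu_mod_uosc : uosc 0 T (fun a b => `|mu_mod T z a - mu_mod T z b|).
Proof.
move=> e e0.
have [eta eta0 H] := uosc_path z_cont (lexx 0) T_ge0 (e := e / 4) ltac:(lra).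
have mod_small : modulus T z (eta / 2) <= e / 4.
  apply: modulus_le; first by lra.
  by move=> p q p0 pq qT qp; apply: ltW; apply: H; rewrite ?ger0_norm; lra.
have key (p q : R) : 0 <= p -> p <= q -> q - p <= eta / 2 -> q - p <= e / 4 ->
    mu_mod T z p <= mu_mod T z q <= mu_mod T z p + e / 2.
  move=> p0 pq qp1 qp2; rewrite /mu_mod.
  have := modulus_mono p0 pq.
  have := @modulus_subadd p (q - p) p0 ltac:(lra); rewrite addrCA subrr addr0.
  have := @modulus_mono (q - p) (eta / 2) ltac:(lra) qp1.
  by move=> *; apply/andP; split; lra.
exists (Num.min (eta / 2) (e / 4)); first by rewrite lt_min; lra.
move=> a b aT bT; rewrite lt_min !ltr_norml => /andP[ab1 ab2].
have [le_ab|le_ab] := lerP a b.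
  by have := key a b ltac:(lra) le_ab ltac:(lra) ltac:(lra); lra.
by have := key b a ltac:(lra) ltac:(lra) ltac:(lra) ltac:(lra); lra.
Qed.

Lemma mu_mod_continuous : {within `[0, T], continuous (mu_mod T z)}.
Proof.
apply/subspace_continuousP => a; rewrite /= in_itv/= => aT.
apply/cvgrPdist_lt => e e0; have [eta eta0 H] := mu_mod_uosc e0.
rewrite near_withinE; apply/nbhs_ballP; exists eta => // b ab.
by rewrite /= in_itv/= => bT; exact: H.
Qed.

Lemma mu_mod0 : mu_mod T z 0 = 0.
Proof.
rewrite /mu_mod add0r; apply/eqP; rewrite eq_le modulus_ge0// andbT.
apply: modulus_le => // p q p0 pq qT qp.
by have -> : q = p; [lra|rewrite subrr enorm0].
Qed.

Lemma mu_mod_ge e : 0 <= e -> e <= mu_mod T z e.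
Proof. by move=> e0; rewrite /mu_mod lerDl modulus_ge0. Qed.

Lemma mu_mod_mono e e' : 0 <= e -> e <= e' -> mu_mod T z e <= mu_mod T z e'.
Proof. by move=> e0 ee; rewrite /mu_mod lerD// modulus_mono. Qed.

(** Values beyond [mu_mod T z T] fall under the default value [T] of the inverse,
    for which the inequality holds as well. *)
Lemma mu_inv_spec (v : R) : 0 < v ->
  0 < mu_inv T z v /\ mu_mod T z (mu_inv T z v) <= v.
Proof.
move=> v0; have [im|nim] := pselect ((mu_mod T z @` `[0, T]) v); last first.
  have -> : mu_inv T z v = T.
    rewrite /mu_inv /pinv_ splitV /=.
    by rewrite [X in odflt _ X](_ : _ = None)//= oinv_surj; case: pselect.
  split=> //; rewrite leNgt; apply/negP => vT; apply: nim.
  have [|c cT <-] := IVT T_ge0 mu_mod_continuous (v := v).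
    by rewrite mu_mod0 ge_min le_max (ltW v0) (ltW vT) orbT.
  by exists c.
have muv := pinvK (fun=> T) (mem_set im); rewrite -/(mu_inv T z v) in muv.
have /= : (`[0, T]%classic) (mu_inv T z v).
  by case: im => x xT <-; apply: funS; exists x.
rewrite in_itv/= => /andP[i0 iT]; split; last by rewrite muv.
rewrite lt_def i0 andbT; apply: contraTneq v0 => e0.
by rewrite -muv e0 mu_mod0 ltxx.
Qed.

End Modulus.

(** * Testing the variational inequality *)

(** Stated for arbitrary functions, to cover [phi] along a test path: the integral of
    a nonnegative function is a supremum over the simple functions below it. *)
Lemma integral_mono d (T : measurableType d) (R : realType)
    (mu : {measure set T -> \bar R}) (D : set T) (f g : T -> \bar R) :
  (forall r, D r -> (f r <= g r)%E) ->
  (\int[mu]_(r in D) f r <= \int[mu]_(r in D) g r)%E.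
Proof.
move=> fg.
have nnmono (f1 f2 : T -> \bar R) : (forall r, 0 <= f1 r)%E -> (forall r, 0 <= f2 r)%E ->
    (forall r, D r -> (f1 r <= f2 r)%E) ->
    (\int[mu]_(r in D) f1 r <= \int[mu]_(r in D) f2 r)%E.
  move=> f10 f20 f12; rewrite !ge0_integralE//.
  apply: ge_ereal_sup => _ [h /= hf <-]; apply: ereal_sup_ubound; exists h => //= r.
  by apply: le_trans (hf r) _; exact: lee_restrict.
rewrite integralE [leRHS]integralE leeB//; apply: nnmono => // r Dr.
  by apply: (funepos_le (D := D)) (mem_set Dr) => q /set_mem; exact: fg.
by apply: (funeneg_le (D := D)) (mem_set Dr) => q /set_mem; exact: fg.
Qed.

Section SkorohodInequality.
Local Set Implicit Arguments.
Local Unset Strict Implicit.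
Context {R : realType} {d : nat} {rho gamma L : R} {phi : 'rV[R]_d -> \bar R}.
Hypotheses (rho_ge0 : 0 <= rho) (gamma_ge0 : 0 <= gamma) (L_ge0 : 0 <= L).
Hypothesis phi_nNy : forall v, phi v != -oo%E.
Hypothesis phi_lsc : lower_semicontinuous phi.
Hypothesis phi_lip : forall u v, edom phi u -> edom phi v ->
  (`|phi u - phi v| <= (L + L * enorm (u - v)%R)%:E)%E.

Lemma edom_fin v : edom phi v -> phi v \is a fin_num.
Proof. by move=> vD; rewrite fin_numE phi_nNy lt_eqF. Qed.

Lemma edom_le u v : edom phi u -> edom phi v ->
  (phi u <= phi v + (L + L * enorm (u - v))%:E)%E.
Proof.
move=> uD vD; have := phi_lip uD vD.
rewrite -(fineK (edom_fin uD)) -(fineK (edom_fin vD)) -EFinB -EFinD !lee_fin.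
by move=> /(le_trans (ler_norm _)); rewrite lerBlDl.
Qed.

(** On its domain [phi] is bounded near [v], so lower semicontinuity keeps [phi v]
    finite. *)
Lemma edom_closed v : closure (edom phi) v -> edom phi v.
Proof.
move=> cv; apply: contrapT => vD.
have vy : phi v = +oo%E.
  by apply/eqP; apply: contra_notT vD; rewrite /edom/= ltey.
have d0 : 0 < d%:R + 1 :> R by rewrite ltr_wpDl.
have [u [uD _]] := cv _ (@nbhsx_ballx _ _ v 1 ltr01).
have [|W nW HW] := phi_lsc (x := v) (a := fine (phi u) + (L + L * (1 + enorm (v - u)))).
  by rewrite vy ltry.
have nB : nbhs v (ball v (1 / (d%:R + 1))) by apply: nbhsx_ballx; rewrite divr_gt0.
have [y [yD [/HW Wy [_ By]]]] := cv _ (filterI nW nB).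
have yv : enorm (y - v) <= 1.
  apply: (@le_trans _ _ (d%:R * (1 / (d%:R + 1)))).
    apply: enorm_le_max => i; rewrite !mxE distrC ltW//.
    by have := By 0 i.
  by rewrite mulrCA mul1r ler_pdivrMr// mul1r lerDl.
have := edom_le yD uD; move: Wy.
rewrite -(fineK (edom_fin yD)) -(fineK (edom_fin uD)) -EFinD lee_fin lte_fin /=.
have := ler_wpM2l L_ge0 (enorm_triangle v y u).
by have := ler_wpM2l L_ge0 yv; lra.
Qed.

Section Solution.
Context {x0 : 'rV[R]_d} {m x k : R -> 'rV[R]_d}.
Hypothesis sol : skorohod_sol rho gamma phi x0 m x k.

Let V r := fine (tvar k r).
Let Q r := rho * r + gamma * V r.
Let bv := sp_bv sol.

Lemma driver_mono p q : 0 <= p -> p <= q -> Q p <= Q q.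
Proof.
move=> p0 pq; rewrite /Q lerD// ler_wpM2l//; exact: tvar_mono.
Qed.

Lemma sol_edom t : 0 <= t -> edom phi (x t).
Proof. by move=> t0; apply: edom_closed; exact: (sp_dom sol). Qed.

Lemma sol_integrable a b : 0 <= a -> a <= b ->
  lebesgue_measure.-integrable `[a, b] (fun r => phi (x r)).
Proof.
move=> a0 ab; apply: integrableS (sp_L1loc sol (le_trans a0 ab)) => //.
by move=> r; rewrite /= !in_itv/=; lra.
Qed.

Lemma sol_integral_fin a b : 0 <= a -> a <= b ->
  (\int[lebesgue_measure]_(r in `[a, b]) phi (x r))%E \is a fin_num.
Proof. by move=> a0 ab; apply: integrable_fin_num => //; exact: sol_integrable. Qed.

Lemma integral_shift y (a b beta : R) : 0 <= a -> a <= b ->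
  (forall r, a <= r <= b -> edom phi (y r) /\ enorm (y r - x r) <= beta) ->
  (\int[lebesgue_measure]_(r in `[a, b]) phi (y r) <=
   \int[lebesgue_measure]_(r in `[a, b]) phi (x r) + ((L + L * beta) * (b - a))%:E)%E.
Proof.
move=> a0 ab Hy.
apply: (@le_trans _ _ (\int[lebesgue_measure]_(r in `[a, b])
   (phi (x r) + cst (L + L * beta)%:E r))%E).
  apply: integral_mono => r; rewrite /= in_itv/= => rab.
  have [yD yx] := Hy r rab.
  apply: le_trans (edom_le yD (sol_edom (t := r) ltac:(lra))) _.
  by rewrite leeD2l// lee_fin lerD2l ler_wpM2l.
rewrite integralD//; last 2 first.
- exact: sol_integrable.
- apply: (@continuous_compact_integrable _ (cst (L + L * beta)) `[a, b]%classic).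
    exact: segment_compact.
  by apply: continuous_subspaceT => r; exact: cvg_cst.
rewrite integral_cst//= lebesgue_measure_itv/= lte_fin.
have [ab'|ba] := ltP a b; first by rewrite -EFinB -EFinM.
by rewrite (_ : b - a = 0) ?mulr0 ?mule0//; lra.
Qed.

(** The defining inequality with both Stieltjes integrals replaced by their one-term
    sums at the left end point; [e] bounds the oscillation of [y - x]. *)
Lemma test_inequality y (a b beta e : R) :
  continuous_Rplus y -> 0 <= a -> a <= b ->
  (forall r, a <= r <= b -> enorm (y r - x r) <= beta) ->
  (forall r, a <= r <= b -> enorm ((y r - x r) - (y a - x a)) <= e) ->
  ((dot (y a - x a) (k b - k a) - d%:R * e * (V b - V a))%:E
     + \int[lebesgue_measure]_(r in `[a, b]) phi (x r) <=
   \int[lebesgue_measure]_(r in `[a, b]) phi (y r)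
     + (enorm (y a - x a) ^+ 2 * (Q b - Q a) + 2 * beta * e * (Q b - Q a))%:E)%E.
Proof.
move=> cy a0 ab ybeta ye.
pose z r := y r - x r.
have cz : continuous_Rplus z.
  by apply: continuous_RplusD => //; apply: continuous_RplusN; exact: (sp_cont_x sol).
have uz := uosc_path cz a0 ab.
have kV p q : a <= p -> p <= q -> q <= b -> enorm (k q - k p) <= V q - V p.
  by move=> ap pq qb; apply: tvar_increment => //; exact: le_trans ap.
have beta0 : 0 <= beta by apply: le_trans (enorm_ge0 _) (ybeta a _); rewrite lexx.
have sqB p q : a <= p <= b -> a <= q <= b ->
    `|enorm (z p) ^+ 2 - enorm (z q) ^+ 2| <= 2 * beta * enorm (z p - z q).
  move=> pab qab; rewrite subr_sqr normrM mulrC ler_pM//.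
    rewrite ger0_norm ?addr_ge0 ?enorm_ge0//.
    by have := ybeta p pab; have := ybeta q qab; rewrite /z; lra.
  rewrite ler_norml; have := enorm_dist (z p) (z q); have := enorm_dist (z q) (z p).
  by rewrite (enormB (z q)); lra.
have uz2 : uosc a b (fun p q => `|enorm (z p) ^+ 2 - enorm (z q) ^+ 2|).
  apply: (@uosc_le _ a b (2 * beta) _ _ _ _ uz uz); first by lra.
  move=> p q pab qab; apply: le_trans (sqB p q pab qab) _.
  by rewrite ler_wpM2l//; [lra|have := enorm_ge0 (z p - z q); lra].
have h1 := stieltjes_dot_approx ab uz kV ye.
have h2 : `|stieltjes_int (fun r => enorm (z r) ^+ 2) Q a b -
    enorm (z a) ^+ 2 * (Q b - Q a)| <= 2 * beta * e * (Q b - Q a).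
  apply: stieltjes_approx => //.
    move=> p q ap pq qb; rewrite ger0_norm// subr_ge0.
    by apply: driver_mono => //; exact: le_trans ap.
  move=> r rab; apply: le_trans (sqB r a rab _) _; first by rewrite lexx.
  by rewrite ler_wpM2l ?ye//; lra.
have abp : 0 <= a <= b by rewrite a0.
have := sp_ineq sol abp cy.
move: h1 h2; rewrite !ler_norml => /andP[h1 _] /andP[_ h2] H.
apply: le_trans (le_trans H _).
  by apply: leeD2r; rewrite lee_fin; move: h1; rewrite /z; lra.
by apply: leeD2l; rewrite lee_fin; move: h2; rewrite /z /Q /V; lra.
Qed.

Lemma test_increment y (a b beta e : R) :
  continuous_Rplus y -> 0 <= a -> a <= b ->
  (forall r, a <= r <= b -> edom phi (y r) /\ enorm (y r - x r) <= beta) ->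
  (forall r, a <= r <= b -> enorm ((y r - x r) - (y a - x a)) <= e) ->
  dot (y a - x a) (k b - k a) <= (L + L * beta) * (b - a)
    + enorm (y a - x a) ^+ 2 * (Q b - Q a)
    + e * (d%:R * (V b - V a) + 2 * beta * (Q b - Q a)).
Proof.
move=> cy a0 ab Hy ye.
have := test_inequality cy a0 ab (fun r rab => (Hy r rab).2) ye.
move=> /le_trans /(_ (leeD2r _ (integral_shift a0 ab Hy))).
rewrite -(fineK (sol_integral_fin a0 ab)) -!EFinD lee_fin; lra.
Qed.

Section InteriorBall.
Context {delta sigma : R}.
Hypothesis ball_cond : shifted_interior_ball gamma delta sigma (edom phi).

(** While [x] stays in the ball of radius [delta], one shift [v] and one radius [lam]
    serve all times, and [x + v + lam u] is an admissible test path for each unit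
    vector [u].  Taking [u] along [k q - k p] bounds this increment by that of a
    function involving [V] itself with the factor [(|v| + lam)^2 gamma]; by
    [tvar_least] the same holds for the increment of [V], and the condition on
    [sigma] allows the term with [V] to be absorbed. *)
Lemma window_tvar s t : 0 <= s -> s <= t ->
  (forall r, s <= r <= t -> enorm (x r - x s) <= delta) ->
  sigma * (V t - V s) <= enorm (k t - k s) + (3 * L + 4 * rho) * (t - s).
Proof.
move=> s0 st xdelta.
have [lam [v [/andP[lam0 lam1] v1 Hsigma Hball]]] := ball_cond (sol_edom s0).
set c := (enorm v + lam) ^+ 2 * gamma in Hsigma.
have c0 : 0 <= c by rewrite mulr_ge0// sqr_ge0.
pose Th r := lam^-1 * ((3 * L + 4 * rho) * r + c * V r - dot v (k r)).
have incr p q : s <= p -> p <= q -> q <= t ->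
    enorm (k q - k p) <= Th q - Th p.
  move=> sp pq qt; rewrite /Th -mulrBr ler_pdivlMl//.
  set dk := k q - k p.
  (* For dk = 0 this is u = 0, and the two properties below still hold. *)
  pose u : 'rV[R]_d := (enorm dk)^-1 *: dk.
  have [u1 udk] : enorm u <= 1 /\ dot u dk = enorm dk.
    rewrite /u enormZ dotZl -enorm_sqr expr2 ger0_norm ?invr_ge0 ?enorm_ge0//.
    have [->|dk0] := eqVneq (enorm dk) 0; first by rewrite !mulr0.
    by rewrite mulVf// mulKf.
  set w := v + lam *: u.
  have wn : enorm w <= enorm v + lam.
    apply: le_trans (enormD _ _) _; rewrite enormZ gtr0_norm//.
    by rewrite lerD2l ger_pMr.
  have wc r : x r + w - x r = w by rewrite addrC addKr.
  have sp0 : 0 <= p by lra.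
  have wQ : enorm w ^+ 2 * (Q q - Q p) <= 4 * (rho * (q - p)) + c * (V q - V p).
    have Vpq := tvar_mono bv sp0 pq; rewrite -/(V p) -/(V q) in Vpq.
    have w2 : enorm w ^+ 2 <= (enorm v + lam) ^+ 2.
      by rewrite ler_sqr ?nnegrE ?addr_ge0 ?enorm_ge0// ltW.
    have w4 : enorm w ^+ 2 <= 4.
      apply: le_trans w2 _; rewrite (_ : 4 = 2 ^+ 2); last by rewrite expr2; lra.
      by rewrite ler_sqr ?nnegrE ?addr_ge0 ?enorm_ge0//; lra.
    have -> : Q q - Q p = rho * (q - p) + gamma * (V q - V p) by rewrite /Q; ring.
    rewrite mulrDr lerD//; first by rewrite ler_wpM2r// mulr_ge0//; lra.
    by rewrite mulrA ler_wpM2r ?subr_ge0// /c ler_wpM2r.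
  have tested : dot v dk + lam * enorm dk <=
      (L + L * 2) * (q - p) + enorm w ^+ 2 * (Q q - Q p).
    rewrite -(wc p) -udk /w -dotZl -dotDl -/w -{1}(wc p).
    have := @test_increment (fun r => x r + w) p q 2 0.
    rewrite mul0r addr0; apply=> //.
    - by apply: continuous_RplusD; [exact: (sp_cont_x sol)|exact: continuous_Rplus_cst].
    - move=> r rpq; rewrite wc; split; last by lra.
      apply: (Hball (x r)).
      + by apply: sol_edom; lra.
      + by rewrite /closed_ball_/= enormB; apply: xdelta; lra.
      + rewrite /closed_ball_/= /w addrA opprD addrA subrr sub0r enormN enormZ.
        by rewrite gtr0_norm// ger_pMr.
    - by move=> r _; rewrite !wc subrr enorm0.
  have -> : (3 * L + 4 * rho) * q + c * V q - dot v (k q) - ((3 * L + 4 * rho) * p + c * V p - dot v (k p)) =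
      (3 * L + 4 * rho) * (q - p) + c * (V q - V p) - dot v dk by rewrite /dk dotBr; ring.
  by lra.
have := tvar_least bv s0 st incr; rewrite -/(V t) -/(V s) /Th -mulrBr ler_pdivlMl//.
have vk : - dot v (k t - k s) <= enorm (k t - k s).
  rewrite -dotNl; apply: le_trans (cauchy_schwarz _ _) _.
  by rewrite enormN ler_piMl// enorm_ge0.
have Vst := tvar_mono bv s0 st; rewrite -/(V s) -/(V t) in Vst.
have : sigma * (V t - V s) <= (lam - c) * (V t - V s) by rewrite ler_wpM2r// subr_ge0.
by move: vk; rewrite dotBr; lra.
Qed.

End InteriorBall.

Lemma increment_k p q : 0 <= p -> 0 <= q -> k q - k p = (m q - m p) - (x q - x p).
Proof.
move=> p0 q0; have E r : 0 <= r -> k r = x0 + m r - x r.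
  by move=> r0; rewrite -(sp_eq sol r0) addrC addKr.
rewrite !E//; apply/rowP => i; rewrite !mxE; ring.
Qed.

(** Energy estimate.  Over a short interval,
    [|k b - k s|^2 - |k a - k s|^2 = 2 <k a - k s, dk> + |dk|^2]; the first term is
    bounded by the test path constantly equal to [x s], and [|dk|^2] is [e] times a
    variation. *)
Lemma window_increment s t (alpha om : R) : 0 <= s -> s <= t ->
  (forall r, s <= r <= t -> enorm (x r - x s) <= alpha) ->
  (forall r, s <= r <= t -> enorm (m r - m s) <= om) ->
  enorm (k t - k s) ^+ 2 <= 2 * (L + L * alpha) * (t - s)
    + 2 * alpha ^+ 2 * (Q t - Q s) + 2 * om * (V t - V s).
Proof.
move=> s0 st xalpha mom.
have alpha0 : 0 <= alpha by apply: le_trans (enorm_ge0 _) (xalpha s _); rewrite lexx.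
(* Collects the discretization errors: those of the test inequality, taken
   twice, and that of |dk|^2. *)
pose W r := 2 * (d%:R * V r + 2 * alpha * Q r) + V r.
have Vmono p q : 0 <= p -> p <= q -> V p <= V q by exact: tvar_mono.
have Wst : 0 <= W t - W s.
  rewrite /W; have := Vmono s t s0 st; have := driver_mono s0 st => Qst Vst.
  have : d%:R * V s <= d%:R * V t by rewrite ler_wpM2l.
  have : alpha * Q s <= alpha * Q t by rewrite ler_wpM2l.
  by lra.
apply: (le_of_small Wst) => e e0.
have [h1 h10 H1] := uosc_path (sp_cont_x sol) s0 st e0.
have [h2 h20 H2] := uosc_path (sp_cont_k sol) s0 st e0.
pose P r := enorm (k r - k s) ^+ 2 <= 2 * (L + L * alpha) * (r - s)
    + 2 * alpha ^+ 2 * (Q r - Q s) + 2 * om * (V r - V s) + e * (W r - W s).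
suff : P t by [].
apply: (@chain_induction _ s t (Num.min h1 h2) P st); first by rewrite lt_min h10.
  move=> a b sa ab bt; rewrite lt_min => /andP[bh1 bh2] Pa.
  have a0 : 0 <= a := le_trans s0 sa.
  set dk := k b - k a.
  have tested : dot (x s - x a) dk <= (L + L * alpha) * (b - a)
      + alpha ^+ 2 * (Q b - Q a) + e * (d%:R * (V b - V a) + 2 * alpha * (Q b - Q a)).
    apply: le_trans (test_increment (y := fun=> x s) (beta := alpha) (e := e) _ a0 ab _ _) _.
    - exact: continuous_Rplus_cst.
    - move=> r rab; split; first exact: sol_edom.
      have /andP[ar rb] := rab.
      by rewrite enormB xalpha// (le_trans sa)// (le_trans rb).
    - move=> r rab; rewrite (_ : _ - _ - _ = x a - x r); last by apply/rowP => i; rewrite !mxE; ring.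
      have /andP[ar rb] := rab; apply/ltW/H1.
      + by rewrite sa (le_trans ab).
      + by rewrite (le_trans sa)// (le_trans rb).
      + by rewrite distrC ger0_norm ?subr_ge0// (le_lt_trans _ bh1)// lerD2r.
    rewrite lerD2r lerD2l ler_wpM2r ?subr_ge0 ?driver_mono//.
    by rewrite ler_sqr ?nnegrE ?enorm_ge0// enormB xalpha// sa (le_trans ab).
  have dkV : enorm dk <= V b - V a by exact: tvar_increment.
  have dke : enorm dk <= e.
    by apply/ltW/H2; rewrite ?sa ?bt ?(le_trans sa)// ?(le_trans ab)// ger0_norm ?subr_ge0.
  have dk2 : enorm dk ^+ 2 <= e * (V b - V a).
    by rewrite expr2 ler_pM ?enorm_ge0.
  have dm : dot (m a - m s) dk <= om * (V b - V a).
    apply: le_trans (cauchy_schwarz _ _) _; rewrite ler_pM ?enorm_ge0//.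
    by apply: mom; rewrite sa (le_trans ab).
  rewrite /P (_ : k b - k s = (k a - k s) + dk); last by apply/rowP => i; rewrite /dk !mxE; ring.
  rewrite enormD_sqr.
  have -> : dot (k a - k s) dk = dot (m a - m s) dk + dot (x s - x a) dk.
    by rewrite increment_k// !dotBl; ring.
  move: Pa tested dk2 dm; rewrite /P /W; clear dkV dke alpha0 Wst.
  move: (V a) (V b) (V s) (Q a) (Q b) (Q s) (dot _ _) (dot _ _) (enorm _) (enorm _).
  by move=> va vb vs qa qb qs p q f g; lra.
by rewrite /P !subrr !mulr0 enorm0 expr0n/= !addr0.
Qed.

End Solution.
End SkorohodInequality.

(** * From windows to a finite horizon *)

(** Constants of the successive estimates: of [k] and [x] in a window, of one step of
    length [h] in terms of [mu_m(h)], and of the growth on [[0, T]]. *)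
Definition square_const {R : realType} (rho L sigma : R) : R :=
  2 * (4 * L + 2 * rho) + 2 * (3 * L + 4 * rho) ^+ 2 + 1 + 5 * (2 / sigma) ^+ 2.

Definition osc_const {R : realType} (rho L sigma : R) : R :=
  4 * (square_const rho L sigma + 1).

Definition step_const {R : realType} (rho L sigma : R) : R :=
  osc_const rho L sigma
    + (2 * square_const rho L sigma + 1 + (3 * L + 4 * rho)) / sigma.

Definition growth_const {R : realType} (rho L sigma : R) : R :=
  2 + 4 * step_const rho L sigma.

Section WindowEstimates.
Local Set Implicit Arguments.
Local Unset Strict Implicit.
Context {R : realType} {d : nat} {x k m : R -> 'rV[R]_d} {V : R -> R}.
Context {rho gamma L delta sigma win T : R}.
Hypotheses (rho_ge0 : 0 <= rho) (gamma_ge0 : 0 <= gamma) (L_ge0 : 0 <= L)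
  (sigma_gt0 : 0 < sigma) (delta_gt0 : 0 < delta) (T_gt0 : 0 < T).
Hypotheses (win_gt0 : 0 < win) (win_delta : win <= delta) (win_le1 : win <= 1)
  (win_gamma : 8 * gamma * win <= sigma).
Hypotheses (x_cont : continuous_Rplus x) (m_cont : continuous_Rplus m).
Hypothesis increment_k : forall p q : R, 0 <= p -> 0 <= q ->
  k q - k p = (m q - m p) - (x q - x p).
Hypothesis increment_V : forall p q : R, 0 <= p -> p <= q ->
  enorm (k q - k p) <= V q - V p.
Hypothesis V0 : V 0 = 0.
Hypothesis window_tvar : forall s t : R, 0 <= s -> s <= t ->
  (forall r, s <= r <= t -> enorm (x r - x s) <= delta) ->
  sigma * (V t - V s) <= enorm (k t - k s) + (3 * L + 4 * rho) * (t - s).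
Hypothesis window_increment : forall s t alpha om : R, 0 <= s -> s <= t ->
  (forall r, s <= r <= t -> enorm (x r - x s) <= alpha) ->
  (forall r, s <= r <= t -> enorm (m r - m s) <= om) ->
  enorm (k t - k s) ^+ 2 <= 2 * (L + L * alpha) * (t - s)
    + 2 * alpha ^+ 2 * (rho * (t - s) + gamma * (V t - V s)) + 2 * om * (V t - V s).

Local Notation C1 := (3 * L + 4 * rho).
Local Notation kap := (2 / sigma).
Local Notation c3 := (square_const rho L sigma).
Local Notation c4 := (osc_const rho L sigma).
Local Notation c5 := (step_const rho L sigma).
Local Notation c6 := (growth_const rho L sigma).

Let C1_ge0 : 0 <= C1. Proof. by move: L_ge0 rho_ge0; lra. Qed.
Let kap_ge0 : 0 <= kap. Proof. by rewrite divr_ge0// ltW. Qed.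
Lemma square_const_ge1 : 1 <= c3.
Proof. by rewrite /square_const; have := sqr_ge0 C1; have := sqr_ge0 kap; move: L_ge0 rho_ge0; lra. Qed.

Let V_mono (p q : R) : 0 <= p -> p <= q -> V p <= V q.
Proof. by move=> p0 pq; rewrite -subr_ge0 (le_trans (enorm_ge0 _) (increment_V p0 pq)). Qed.

Let increment_x (p q : R) : 0 <= p -> 0 <= q ->
  x q - x p = (m q - m p) - (k q - k p).
Proof. by move=> p0 q0; rewrite increment_k// opprB addrCA subrr addr0. Qed.

(** Young's inequality absorbs every occurrence of [K] on the right into [K^2]. *)
Lemma young_window (K h om : R) : 0 <= K -> 0 <= h -> 0 <= om ->
  K ^+ 2 <= (4 * L + 2 * rho) * h + (K + om) / 4 * (K + C1 * h)
    + kap * om * (K + C1 * h) ->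
  K ^+ 2 <= c3 * (h + h ^+ 2 + om ^+ 2).
Proof.
move=> K0 h0 om0 HK.
have y1 := sqr_ge0 (K - 2 * (C1 * h)).
have y2 := sqr_ge0 (K - 2 * om).
have y3 := sqr_ge0 (K - 4 * (kap * om)).
have y4 := sqr_ge0 (om - C1 * h).
have y5 := sqr_ge0 (kap * om - C1 * h).
have D0 : 0 <= 4 * L + 2 * rho by move: L_ge0 rho_ge0; lra.
have p1 : 0 <= (4 * L + 2 * rho) * (h ^+ 2 + om ^+ 2) by rewrite mulr_ge0// addr_ge0// sqr_ge0.
have p2 : 0 <= C1 ^+ 2 * (h + om ^+ 2) by rewrite mulr_ge0 ?sqr_ge0// addr_ge0// sqr_ge0.
have p3 : 0 <= kap ^+ 2 * (h + h ^+ 2) by rewrite mulr_ge0 ?sqr_ge0// addr_ge0// sqr_ge0.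
have p4 : 0 <= (C1 * h) ^+ 2 by rewrite sqr_ge0.
have p5 : 0 <= (kap * om) ^+ 2 by rewrite sqr_ge0.
have p6 := sqr_ge0 h; have p7 := sqr_ge0 om.
move: HK y1 y2 y3 y4 y5 p1 p2 p3 p4 p5 p6 p7 h0; rewrite /square_const; move: (C1) (kap) => c l.
by lra.
Qed.

(** [K] is the supremum of [|k - k s|] over the window.  The bound of [|x - x s|] by
    [win] makes [al^2 <= win (K + om)], so the term [2 al^2 gamma (V r - V s)]
    is at most [(K + om) / 4] times the bound of [sigma (V r - V s)]. *)
Lemma window_square s t (om : R) : 0 <= s -> s <= t ->
  (forall r, s <= r <= t -> enorm (x r - x s) <= win) ->
  (forall r, s <= r <= t -> enorm (m r - m s) <= om) ->
  forall r, s <= r <= t -> enorm (k r - k s) ^+ 2 <= c3 * ((t - s) + (t - s) ^+ 2 + om ^+ 2).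
Proof.
move=> s0 st xdl mom.
pose S := [set enorm (k r - k s) | r in `[s, t]%classic].
pose K := sup S.
have Sub : has_ubound S.
  exists (V t - V s) => _ [r + <-]; rewrite /= in_itv/= => /andP[sr rt].
  have := increment_V s0 sr; have := @V_mono r t ltac:(lra) rt.
  by lra.
have leK r : s <= r <= t -> enorm (k r - k s) <= K.
  by move=> rst; apply: ub_le_sup => //; exists r => //; rewrite /= in_itv.
have K0 : 0 <= K by apply: le_trans (enorm_ge0 _) (leK s _); rewrite lexx.
have om0 : 0 <= om by apply: le_trans (enorm_ge0 _) (mom s _); rewrite lexx.
set h := t - s; have h0 : 0 <= h by rewrite subr_ge0.
pose N := K + C1 * h.
pose RHS := (4 * L + 2 * rho) * h + (K + om) / 4 * N + kap * om * N.
have claim r : s <= r <= t -> enorm (k r - k s) ^+ 2 <= RHS.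
  move=> /andP[sr rt].
  pose al := Num.min win (K + om).
  have al_dl : al <= win by rewrite /al ge_min lexx.
  have al_K : al <= K + om by rewrite /al ge_min lexx orbT.
  have al0 : 0 <= al by rewrite /al le_min (ltW win_gt0) addr_ge0.
  have xal q : s <= q <= r -> enorm (x q - x s) <= al.
    move=> /andP[sq qr]; have qst : s <= q <= t by rewrite sq (le_trans qr).
    rewrite /al le_min xdl//=.
    rewrite increment_x ?(le_trans s0)//.
    by apply: le_trans (enormD _ _) _; rewrite enormN addrC lerD ?leK ?mom.
  have H := window_increment s0 sr xal.
  have mr q : s <= q <= r -> enorm (m q - m s) <= om.
    by move=> /andP[sq qr]; rewrite mom// sq (le_trans qr).
  have {}H := H om mr.
  apply: le_trans H _.
  have dV0 : 0 <= V r - V s by rewrite subr_ge0 V_mono.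
  set dV := V r - V s in dV0 *.
  have rsh : r - s <= h by rewrite lerB.
  have rs0 : 0 <= r - s by rewrite subr_ge0.
  have HV : sigma * dV <= N.
    have xr q : s <= q <= r -> enorm (x q - x s) <= delta.
      by move=> qr; apply: le_trans (xal q qr) (le_trans al_dl win_delta).
    apply: le_trans (window_tvar s0 sr xr) _.
    by rewrite lerD ?leK ?sr// ler_wpM2l.
  have N0 : 0 <= N by rewrite addr_ge0// mulr_ge0.
  have al1 : al <= 1 by apply: le_trans al_dl win_le1.
  have t1 : 2 * (L + L * al) * (r - s) <= 4 * L * h.
    apply: ler_pM => //; first by rewrite mulr_ge0// addr_ge0// mulr_ge0.
    by have := ler_wpM2l L_ge0 al1; lra.
  have t2 : 2 * al ^+ 2 * (rho * (r - s)) <= 2 * rho * h.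
    rewrite -mulrA -mulrA ler_wpM2l// -[leRHS]mul1r ler_pM ?mulr_ge0 ?sqr_ge0//.
      by rewrite expr_le1.
    by rewrite ler_wpM2l.
  have t3 : 2 * al ^+ 2 * (gamma * dV) <= (K + om) / 4 * N.
    apply: (@le_trans _ _ (2 * (win * (K + om)) * (gamma * dV))).
      by rewrite ler_wpM2r ?mulr_ge0// ler_wpM2l// expr2 ler_pM.
    have -> : 2 * (win * (K + om)) * (gamma * dV) = (K + om) / 4 * (8 * gamma * win * dV).
      by field.
    rewrite ler_wpM2l ?divr_ge0 ?addr_ge0//.
    by apply: le_trans HV; rewrite ler_wpM2r.
  have t4 : 2 * om * dV <= kap * om * N.
    have -> : 2 * om * dV = kap * om * (sigma * dV) by field; exact: lt0r_neq0.
    by rewrite ler_wpM2l// mulr_ge0.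
  by move: t1 t2 t3 t4; rewrite /RHS; lra.
have RHS0 : 0 <= RHS by apply: le_trans (sqr_ge0 _) (claim s _); rewrite lexx.
have KR : K ^+ 2 <= RHS.
  rewrite -(sqr_sqrtr RHS0) ler_sqr ?nnegrE ?sqrtr_ge0//.
  apply: ge_sup; first by exists (enorm (k s - k s)), s => //; rewrite /= in_itv/= lexx.
  move=> _ [r + <-]; rewrite /= in_itv/= => rst.
  by rewrite -(ler_sqr (enorm_ge0 _) (sqrtr_ge0 _)) (sqr_sqrtr RHS0) claim.
move=> r rst; apply: (@le_trans _ _ (K ^+ 2)).
  by rewrite ler_sqr ?nnegrE ?enorm_ge0 ?leK.
exact: young_window.
Qed.

Local Notation M := (sup_norm T m).
Local Notation P := (1 + T + M).
Local Notation mu := (mu_mod T m).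

Let T_ge0 : 0 <= T. Proof. exact: ltW. Qed.
Let M_ge0 : 0 <= M. Proof. exact: sup_norm_ge0. Qed.
Let P_ge1 : 1 <= P. Proof. by move: T_ge0 M_ge0; lra. Qed.
Let mu_ge0 (h : R) : 0 <= h -> 0 <= mu h.
Proof. by move=> h0; apply: le_trans h0 (mu_mod_ge m_cont T_gt0 h0). Qed.

Lemma window_mu s t : 0 <= s -> s <= t -> t <= T ->
  (forall r, s <= r <= t -> enorm (x r - x s) <= win) ->
  forall r, s <= r <= t ->
    enorm (k r - k s) ^+ 2 <= 2 * c3 * (P * mu (t - s)) /\
    enorm (x r - x s) ^+ 2 <= c4 * (P * mu (t - s)).
Proof.
move=> s0 st tT xdl r rst; set h := t - s.
have h0 : 0 <= h by rewrite subr_ge0.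
set om := modulus T m h.
have om0 : 0 <= om by exact: modulus_ge0.
have om2 : om <= 2 * M by exact: modulus_le_sup.
have mom q : s <= q <= t -> enorm (m q - m s) <= om.
  move=> /andP[sq qt]; apply: modulus_ge => //.
  - by rewrite (le_trans s0 sq) (le_trans qt tT).
  - by rewrite s0 (le_trans st tT).
  - by rewrite ger0_norm ?subr_ge0// lerB.
have hT : h <= T by move: s0 tT; rewrite /h; lra.
have q1 : h ^+ 2 <= T * h by rewrite expr2 ler_wpM2r.
have q2 : om ^+ 2 <= 2 * M * om by rewrite expr2 ler_wpM2r.
have q3 : 0 <= T * om by rewrite mulr_ge0.
have q4 : 0 <= M * h by rewrite mulr_ge0.
have q5 : 0 <= T * h by rewrite mulr_ge0.
have small : h + h ^+ 2 + om ^+ 2 <= 2 * (P * mu h).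
  by rewrite /mu_mod -/om; move: h0 om0 q1 q2 q3 q4 q5; lra.
have Hk : enorm (k r - k s) ^+ 2 <= 2 * c3 * (P * mu h).
  apply: le_trans (window_square s0 st xdl mom rst) _.
  by rewrite (mulrC 2 c3) -mulrA ler_wpM2l// (le_trans ler01 square_const_ge1).
split=> //.
have q6 : om ^+ 2 <= 2 * (P * mu h) by move: small h0 (sqr_ge0 h); lra.
have /andP[sr rt] := rst.
rewrite increment_x ?(le_trans s0)//.
have tri := enormD (m r - m s) (- (k r - k s)); rewrite enormN in tri.
have mr := mom r rst.
apply: (@le_trans _ _ ((om + enorm (k r - k s)) ^+ 2)).
  rewrite ler_sqr ?nnegrE ?addr_ge0 ?enorm_ge0//.
  by apply: le_trans tri _; rewrite lerD2r.
have := sqr_ge0 (om - enorm (k r - k s)).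
by move: q6 Hk; rewrite /osc_const; move: (P * mu h) => w; move: (enorm _) => a; lra.
Qed.

(** As long as [x] has stayed in the window it is in fact at distance at most
    [Num.sqrt B < win] from [x s], which leaves room for one more short interval. *)
Lemma window_stay s t : 0 <= s -> s <= t -> t <= T ->
  c4 * (P * mu (t - s)) < win ^+ 2 ->
  forall r, s <= r <= t -> enorm (x r - x s) <= win.
Proof.
move=> s0 st tT small.
have h0 : 0 <= t - s by rewrite subr_ge0.
set B := c4 * (P * mu (t - s)) in small.
have P0 : 0 <= P by apply: le_trans P_ge1.
have c40 : 0 <= c4 by move: square_const_ge1; rewrite /osc_const; lra.
have B0 : 0 <= B by apply: mulr_ge0 => //; apply: mulr_ge0 => //; exact: mu_ge0.
have sB : Num.sqrt B < win.
  by rewrite -(ltr_sqr (sqrtr_ge0 _) (ltW win_gt0)) sqr_sqrtr.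
have e0 : 0 < win - Num.sqrt B by rewrite subr_gt0.
have [eta eta0 H] := uosc_path x_cont s0 st e0.
pose W r := forall q, s <= q <= r -> enorm (x q - x s) <= win.
apply: (@chain_induction _ s t eta W) => //.
  move=> a b sa ab bt bh Wa q /andP[sq qb].
  have [qa|qa] := lerP q a; first by apply: Wa; rewrite sq.
  have xa : enorm (x a - x s) <= Num.sqrt B.
    rewrite -(ler_sqr (enorm_ge0 _) (sqrtr_ge0 _)) (sqr_sqrtr B0).
    have aT : a <= T by rewrite (le_trans ab)// (le_trans bt).
    have asa : s <= a <= a by rewrite sa lexx.
    apply: le_trans (window_mu s0 sa aT Wa asa).2 _.
    rewrite ler_wpM2l// ler_wpM2l// mu_mod_mono ?subr_ge0//.
    by rewrite lerD2r (le_trans ab).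
  have xq : enorm (x q - x a) < win - Num.sqrt B.
    apply: H; rewrite ?sq ?sa ?(le_trans qb)// ?(le_trans ab)//.
    by rewrite gtr0_norm ?subr_gt0//; apply: le_lt_trans bh; rewrite lerD2r.
  by have := enorm_triangle (x a) (x q) (x s); move: xa xq; lra.
move=> q; rewrite -eq_le => /eqP <-.
by rewrite subrr enorm0 ltW.
Qed.

Lemma step_const_ge1 : 1 <= c5.
Proof.
have : 0 <= (2 * c3 + 1 + C1) / sigma.
  by rewrite divr_ge0 ?(ltW sigma_gt0)//; move: square_const_ge1 C1_ge0; lra.
by move: square_const_ge1; rewrite /step_const /osc_const; lra.
Qed.

Lemma short_increment s t : 0 <= s -> s <= t -> t <= T ->
  c4 * (P * mu (t - s)) < win ^+ 2 ->
  enorm (x t - x s) + (V t - V s) <= c5 * (P * Num.sqrt (mu (t - s))).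
Proof.
move=> s0 st tT small; have stay := window_stay s0 st tT small.
have tst : s <= t <= t by rewrite st lexx.
have [Hk Hx] := window_mu s0 st tT stay tst.
have h0 : 0 <= t - s by rewrite subr_ge0.
have mu0 := mu_ge0 h0.
have P0 : 0 <= P by apply: le_trans P_ge1.
set S := Num.sqrt (P * mu (t - s)).
have S2 : S ^+ 2 = P * mu (t - s) by rewrite sqr_sqrtr// mulr_ge0.
have S0 : 0 <= S := sqrtr_ge0 _.
have root a c : 0 <= a -> 0 <= c -> c <= a ^+ 2 -> forall u, 0 <= u ->
    u ^+ 2 <= c * (P * mu (t - s)) -> u <= a * S.
  move=> a0 c0 ca u u0 uc; rewrite -(ler_sqr u0) ?nnegrE ?mulr_ge0//.
  by apply: le_trans uc _; rewrite exprMn S2 ler_wpM2r ?mulr_ge0.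
have kS : enorm (k t - k s) <= (2 * c3 + 1) * S.
  apply: root Hk; rewrite ?enorm_ge0//; [move: square_const_ge1; lra..|].
  by have := sqr_ge0 c3; move: square_const_ge1; lra.
have xS : enorm (x t - x s) <= c4 * S.
  apply: root Hx; rewrite ?enorm_ge0// /osc_const; [move: square_const_ge1; lra..|].
  by have := sqr_ge0 c3; move: square_const_ge1; lra.
have hS : t - s <= 1 * S.
  apply: (root 1 1) => //; first by rewrite expr1n.
  rewrite mul1r expr2 ler_pM//; last exact: mu_mod_ge.
  by move: s0 tT M_ge0; lra.
have VS : V t - V s <= (2 * c3 + 1 + C1) / sigma * S.
  rewrite mulrAC ler_pdivlMr// mulrC.
  apply: le_trans (window_tvar s0 st _) _.
    by move=> r rst; apply: le_trans (stay r rst) win_delta.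
  have := ler_wpM2l C1_ge0 hS; move: kS; lra.
have SP : S <= P * Num.sqrt (mu (t - s)).
  rewrite /S sqrtrM// ler_wpM2r ?sqrtr_ge0//.
  rewrite -(ler_sqr (sqrtr_ge0 _) P0) sqr_sqrtr// expr2 ler_peMl//.
apply: (@le_trans _ _ (c5 * S)); first by move: xS VS; rewrite /step_const; lra.
by rewrite ler_wpM2l// (le_trans _ step_const_ge1).
Qed.

Section Scale.
Context {h0 : R}.
Hypotheses (h0_gt0 : 0 < h0) (h0_small : c4 * (P * mu h0) < win ^+ 2).

Local Notation Y := (P + h0^-1).

Let h0V_gt0 : 0 < h0^-1. Proof. by rewrite invr_gt0. Qed.

Lemma below_scale s t : 0 <= s -> s <= t -> t <= T -> t - s <= h0 ->
  enorm (x t - x s) + (V t - V s) <= c5 * (P * Num.sqrt (mu (t - s))).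
Proof.
move=> s0 st tT sth; apply: short_increment => //; apply: le_lt_trans h0_small.
have P0 : 0 <= P by apply: le_trans P_ge1.
have c40 : 0 <= c4 by move: square_const_ge1; rewrite /osc_const; lra.
by rewrite ler_wpM2l// ler_wpM2l// mu_mod_mono// subr_ge0.
Qed.

(** Each of the at most [T / h0 + 1] steps of length at most [h0] contributes
    [c5 * P]. *)
Lemma tvar_bound : V T <= 2 * c5 * Y ^+ 3.
Proof.
have P0 : 0 <= P by apply: le_trans P_ge1.
have P1 := P_ge1.
have step s t : 0 <= s -> s <= t -> t <= T -> t - s <= h0 -> V t - V s <= c5 * P.
  move=> s0 st tT sth.
  have st0 : 0 <= t - s by rewrite subr_ge0.
  have := below_scale s0 st tT sth; have := enorm_ge0 (x t - x s).
  have : Num.sqrt (mu (t - s)) <= 1.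
    rewrite -[leRHS]sqrtr1 ler_wsqrtr//.
    apply: le_trans (mu_mod_mono m_cont T_gt0 st0 sth) _.
    have c4P : 1 <= c4 * P.
      rewrite -[leLHS]mulr1 ler_pM//; move: square_const_ge1; rewrite /osc_const; lra.
    have mu0 : 0 <= mu h0 by rewrite mu_ge0// ltW.
    have d1 : win ^+ 2 <= 1 by rewrite expr_le1// ltW.
    have := ler_wpM2r mu0 c4P; move: h0_small d1; lra.
  move=> /(ler_wpM2l P0) /(ler_wpM2l (le_trans ler01 step_const_ge1)).
  by lra.
pose n := (Num.truncn (T / h0)).+1.
have n0 : 0 < n%:R :> R by rewrite ltr0n.
have Tn : T / n%:R <= h0.
  rewrite ler_pdivrMr// mulrC -ler_pdivrMr//; apply: ltW.
  by rewrite /n; apply: truncnS_gt.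
have nT : n%:R <= T / h0 + 1.
  rewrite /n -natr1 lerD2r truncn_le.
  by rewrite divr_ge0// ltW.
pose tau := T / n%:R.
have tau0 : 0 <= tau by rewrite divr_ge0// ltW.
have Vi i : (i <= n)%N -> V (i%:R * tau) <= i%:R * (c5 * P).
  elim: i => [_|i IH ilt]; first by rewrite !mul0r V0.
  have i1 : i.+1%:R * tau = i%:R * tau + tau by rewrite -natr1 mulrDl mul1r.
  have iT : i.+1%:R * tau <= T.
    by rewrite /tau mulrCA -[leRHS]mulr1 ler_wpM2l// ler_pdivrMr// mul1r ler_nat.
  rewrite i1 in iT *.
  have := step (i%:R * tau) (i%:R * tau + tau) (mulr_ge0 (ler0n _ _) tau0).
  rewrite lerDl addrAC subrr add0r => /(_ tau0 iT Tn).
  have := IH (ltnW ilt); rewrite -[i.+1%:R]natr1 [X in _ -> _ -> _ <= X]mulrDl mul1r.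
  by lra.
have := Vi n (leqnn n); rewrite /tau mulrCA mulfV ?gt_eqF// mulr1 => VT.
have D0 := ltW h0V_gt0.
have TP : T <= P by move: M_ge0; lra.
have nPD : n%:R <= P * h0^-1 + 1.
  by apply: le_trans nT _; rewrite lerD2r ler_wpM2r.
apply: le_trans VT _.
have c50 : 0 <= c5 := le_trans ler01 step_const_ge1.
rewrite mulrCA (mulrC 2) -mulrA ler_wpM2l//.
apply: le_trans (ler_wpM2r P0 nPD) _.
have Y1 : 1 <= Y by move: P1 D0; lra.
have PY : P <= Y by rewrite lerDl.
have DY : h0^-1 <= Y by rewrite lerDr.
have Y0 : 0 <= Y := le_trans ler01 Y1.
have PDY : P * h0^-1 <= Y ^+ 2 by rewrite expr2 ler_pM.
have Y2 : 1 <= Y ^+ 2 by rewrite expr_ge1.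
rewrite exprSr mulrA ler_pM//; first by rewrite addr_ge0// mulr_ge0.
by move: PDY Y2; lra.
Qed.

(** Beyond the scale [h0] nothing better than the total bounds is available, but there
    [mu (t - s) >= h0], so [Y * Num.sqrt (mu (t - s)) >= 1]. *)
Lemma scale_bounds :
  [/\ V T <= c6 * Y ^+ 4, M + V T <= c6 * Y ^+ 4, T <= c6 * Y ^+ 4 &
   forall s t, 0 <= s -> s <= t -> t <= T ->
     enorm (x t - x s) + (V t - V s) <= c6 * Y ^+ 4 * Num.sqrt (mu (t - s))].
Proof.
have VT := tvar_bound.
have P1 := P_ge1; have D0 := h0V_gt0; have M0 := M_ge0; have c51 := step_const_ge1.
have Y1 : 1 <= Y by move: P1 D0; lra.
have Y0 : 0 <= Y := le_trans ler01 Y1.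
have MY : M <= Y by move: M0 D0 T_ge0; lra.
have TY : T <= Y by move: M0 D0; lra.
have Y3 : 0 <= Y ^+ 3 by rewrite exprn_ge0.
have Y13 : Y <= Y ^+ 3 by rewrite exprS ler_peMr// exprn_ege1.
have Y34 : Y ^+ 3 <= Y ^+ 4 by rewrite [leRHS]exprS ler_peMl.
have c5Y : 0 <= c5 * Y ^+ 3 by rewrite mulr_ge0// (le_trans ler01).
have c5Y34 : c5 * Y ^+ 3 <= c5 * Y ^+ 4 by rewrite ler_wpM2l// (le_trans ler01).
have c5Y1 : Y ^+ 3 <= c5 * Y ^+ 3 by rewrite ler_peMl.
split.
- by rewrite /growth_const; move: VT c5Y c5Y34 Y3 Y34; lra.
- by rewrite /growth_const; move: VT MY Y13 c5Y c5Y34 Y3 Y34; lra.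
- by rewrite /growth_const; move: TY Y13 c5Y c5Y34 Y3 Y34; lra.
move=> s t s0 st tT.
have sq0 := sqrtr_ge0 (mu (t - s)); set sq := Num.sqrt _ in sq0 *.
have [hs|hs] := lerP (t - s) h0.
  apply: le_trans (below_scale s0 st tT hs) _; rewrite -/sq mulrA ler_wpM2r//.
  apply: (@le_trans _ _ (c5 * Y ^+ 4)).
    rewrite ler_wpM2l ?(le_trans ler01)//.
    by apply: le_trans (le_trans Y13 Y34); rewrite lerDl ltW.
  by rewrite /growth_const; move: c5Y c5Y34 Y3 Y34; lra.
have sqY : 1 <= Y * sq.
  have hmu : h0 <= mu (t - s).
    by apply: le_trans (ltW hs) (mu_mod_ge m_cont T_gt0 _); rewrite subr_ge0.
  have DY : h0^-1 <= Y by move: P1; lra.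
  have : 1 <= Y ^+ 2 * mu (t - s).
    rewrite -[leLHS](mulVf (x := h0)) ?gt_eqF// ler_pM// ?(ltW h0_gt0)// ?(ltW D0)//.
    by apply: le_trans DY _; rewrite expr2 ler_peMl.
  rewrite -(sqr_sqrtr (mu_ge0 (h := t - s) _)) ?subr_ge0// -/sq -exprMn.
  by rewrite -[leLHS](expr1n _ 2) ler_sqr ?nnegrE ?mulr_ge0.
have xx : enorm (x t - x s) <= 2 * M + V T.
  rewrite increment_x ?(le_trans s0)//.
  have t0 : 0 <= t := le_trans s0 st.
  have mt : enorm (m t) <= M by apply: sup_norm_ge => //; rewrite t0.
  have ms : enorm (m s) <= M by apply: sup_norm_ge => //; rewrite s0 (le_trans st).
  have kV : enorm (k t - k s) <= V T.
    apply: le_trans (increment_V s0 st) _.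
    by have := V_mono t0 tT; have := V_mono (lexx 0) s0; rewrite V0; lra.
  have := enormD (m t - m s) (- (k t - k s)); have := enormD (m t) (- m s).
  by rewrite !enormN; move: mt ms kV; lra.
have VV : V t - V s <= V T.
  by have := V_mono (le_trans s0 st) tT; have := V_mono (lexx 0) s0; rewrite V0; lra.
apply: (@le_trans _ _ (c6 * Y ^+ 3)).
  by rewrite /growth_const; move: xx VV VT MY Y13; lra.
have c6Y : 0 <= c6 * Y ^+ 3 by rewrite mulr_ge0// /growth_const; move: c51; lra.
rewrite -[leLHS]mulr1; apply: le_trans (ler_wpM2l c6Y sqY) _.
by rewrite (exprSr Y 3) !mulrA.
Qed.

End Scale.

(** For [h = 1 / Delta] one has [mu h <= delta^2 exp (- C P)], and
    [P exp (- C P) <= 1 / C] brings [c4 P mu h] below [win^2] for large [C]. *)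
Lemma horizon_bounds (C : R) : c6 + 4 <= C -> c4 * delta ^+ 2 < C * win ^+ 2 ->
  [/\ V T <= CT delta C T m, M + V T <= CT delta C T m, T <= CT delta C T m &
   forall s t, 0 <= s -> s <= t -> t <= T ->
     enorm (x t - x s) + (V t - V s) <= CT delta C T m * Num.sqrt (mu (t - s))].
Proof.
move=> C6 C4.
have P1 := P_ge1; have c51 := step_const_ge1.
have P0 : 0 < P := lt_le_trans ltr01 P1.
have c60 : 0 <= c6 by rewrite /growth_const; lra.
have C0 : 0 < C by lra.
have c40 : 0 <= c4 by move: square_const_ge1; rewrite /osc_const; lra.
rewrite /CT /Delta; set v := delta ^+ 2 * expR _.
have v0 : 0 < v by rewrite mulr_gt0 ?expR_gt0// exprn_gt0.
have [h0_gt0 h0_mu] := mu_inv_spec m_cont T_gt0 v0.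
set h := mu_inv T m v in h0_gt0 h0_mu *.
have small : c4 * (P * mu h) < win ^+ 2.
  have CP0 : 0 < C * P by rewrite mulr_gt0.
  have expCP : P * expR (- (C * P)) <= C^-1.
    rewrite expRN ler_pdivrMr ?expR_gt0// mulrC ler_pdivlMr// mulrC.
    by apply: le_trans (expR_ge1Dx _); lra.
  apply: (@le_lt_trans _ _ (c4 * delta ^+ 2 * C^-1)); last first.
    by rewrite ltr_pdivrMr// mulrC (mulrC (win ^+ 2)) mulrC.
  rewrite -mulrA ler_wpM2l//; apply: le_trans (ler_wpM2l (ltW P0) h0_mu) _.
  by rewrite /v mulrCA ler_wpM2l ?sqr_ge0.
have hV0 : 0 < h^-1 by rewrite invr_gt0.
have Y1 : 1 <= P + h^-1 by lra.
have Y0 : 0 <= P + h^-1 := le_trans ler01 Y1.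
have growth : c6 * (P + h^-1) ^+ 4 <= expR (C * (P + h^-1)).
  set Y := P + h^-1 in Y0 Y1 *.
  apply: (@le_trans _ _ (expR (c6 * Y + 4%:R * Y))); last first.
    by rewrite ler_expR -mulrDl ler_wpM2r.
  rewrite expRD expRM_natl ler_pM ?exprn_ge0//.
    apply: le_trans (expR_ge1Dx _); have := ler_wpM2l c60 Y1; lra.
  by rewrite lerXn2r ?nnegrE ?expR_ge0//; apply: le_trans (expR_ge1Dx _); lra.
have [b1 b2 b3 b4] := scale_bounds h0_gt0 small.
split.
- exact: le_trans b1 growth.
- exact: le_trans b2 growth.
- exact: le_trans b3 growth.
- move=> s t s0 st tT; apply: le_trans (b4 s t s0 st tT) _.
  by rewrite ler_wpM2r ?sqrtr_ge0.
Qed.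

End WindowEstimates.

(** * Gronwall estimate for two solutions *)

Section Stability.
Local Set Implicit Arguments.
Local Unset Strict Implicit.
Context {R : realType} {d : nat} {rho gamma : R} {phi : 'rV[R]_d -> \bar R}.
Hypotheses (rho_ge0 : 0 <= rho) (gamma_ge0 : 0 <= gamma).
Context {x0 hx0 : 'rV[R]_d} {m x k hm hx hk : R -> 'rV[R]_d}.
Hypothesis sol : skorohod_sol rho gamma phi x0 m x k.
Hypothesis hsol : skorohod_sol rho gamma phi hx0 hm hx hk.

Let V r := fine (tvar k r).
Let Q r := rho * r + gamma * V r.
Let hV r := fine (tvar hk r).
Let hQ r := rho * r + gamma * hV r.
Let z r := x r - hx r.
Let kap r := k r - hk r.
Let W r := Q r + hQ r + V r + hV r.

(** The two inequalities, each tested with the other solution, are added; the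
    integrals of [phi] along [x] and [hx] are finite and cancel.  [W] dominates both
    variations and both integrators at once. *)
Lemma difference_increment a b (beta e : R) : 0 <= a -> a <= b -> 0 <= e ->
  (forall r, a <= r <= b -> enorm (z r) <= beta) ->
  (forall r, a <= r <= b -> enorm (z r - z a) <= e) ->
  - dot (z a) (kap b - kap a) <=
    enorm (z a) ^+ 2 * (W b - W a) + e * ((d%:R + 2 * beta) * (W b - W a)).
Proof.
move=> a0 ab e0 zbeta ze.
have I1 : forall r, a <= r <= b -> enorm (hx r - x r) <= beta.
  by move=> r rab; rewrite enormB zbeta.
have I2 : forall r, a <= r <= b -> enorm ((hx r - x r) - (hx a - x a)) <= e.
  move=> r rab; rewrite (_ : _ - _ = - (z r - z a)) ?enormN ?ze//.
  by rewrite /z; apply/rowP => i; rewrite !mxE; ring.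
have := test_inequality rho_ge0 gamma_ge0 sol (sp_cont_x hsol) a0 ab I1 I2.
have := test_inequality rho_ge0 gamma_ge0 hsol (sp_cont_x sol) a0 ab zbeta ze.
rewrite -(fineK (sol_integral_fin sol a0 ab)) -(fineK (sol_integral_fin hsol a0 ab)).
rewrite -!EFinD !lee_fin -/(V a) -/(V b) -/(hV a) -/(hV b).
rewrite -/(Q a) -/(Q b) -/(hQ a) -/(hQ b) -/(z a) (enormB (hx a)) -/(z a).
have -> : hx a - x a = - z a by rewrite opprB.
rewrite dotNl.
have -> : dot (z a) (kap b - kap a) = dot (z a) (k b - k a) - dot (z a) (hk b - hk a).
  rewrite -dotBr; congr dot; apply/rowP => i; rewrite !mxE; ring.
have b0 : 0 <= beta by apply: le_trans (enorm_ge0 _) (zbeta a _); rewrite lexx.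
have VV := tvar_mono (sp_bv sol) a0 ab; have hVV := tvar_mono (sp_bv hsol) a0 ab.
have QQ := driver_mono rho_ge0 gamma_ge0 sol a0 ab.
have hQQ := driver_mono rho_ge0 gamma_ge0 hsol a0 ab.
rewrite -/(V a) -/(V b) -/(hV a) -/(hV b) in VV hVV QQ hQQ.
rewrite -/(Q a) -/(Q b) -/(hQ a) -/(hQ b) in QQ hQQ.
have e1 : 0 <= e * d%:R * (Q b - Q a + (hQ b - hQ a)).
  by apply: mulr_ge0; [exact: mulr_ge0|rewrite addr_ge0 ?subr_ge0].
have e2 : 0 <= e * beta * (V b - V a + (hV b - hV a)).
  by apply: mulr_ge0; [exact: mulr_ge0|rewrite addr_ge0 ?subr_ge0].
have e3 : 0 <= enorm (z a) ^+ 2 * (V b - V a + (hV b - hV a)).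
  by apply: mulr_ge0; [exact: sqr_ge0|rewrite addr_ge0 ?subr_ge0].
move: e1 e2 e3; clear VV hVV QQ hQQ b0 e0 ab a0; rewrite /W /Q /hQ.
move: (fine _) (fine _) (V a) (V b) (hV a) (hV b) (dot _ _) (dot _ _) (enorm _).
by move=> i j va vb hva hvb p q n; lra.
Qed.

Context {T n0 : R}.
Hypothesis T_ge0 : 0 <= T.
Hypothesis m_close : forall r, 0 <= r <= T -> enorm (m r - hm r) <= n0.

(** With [F = |kap - z0|^2] each short interval gives
    [F b + A <= (F a + A) (1 + 4 (W b - W a))], and [1 + u <= exp u] makes
    [(F + A) exp (- 4 W)] nonincreasing.  The discretization error is the part of [A]
    that contains [e]. *)
Lemma stieltjes_gronwall t : 0 <= t <= T ->
  enorm (kap t - (x0 - hx0)) ^+ 2 <=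
    (enorm (x0 - hx0) ^+ 2 + n0 ^+ 2 + n0) * expR (4 * W T).
Proof.
set z0 := x0 - hx0 => /andP[t0 tT].
have n00 : 0 <= n0 by apply: le_trans (enorm_ge0 _) (m_close (r := 0) _); rewrite lexx T_ge0.
have Vm p q : 0 <= p -> p <= q -> V p <= V q by exact: (tvar_mono (sp_bv sol)).
have hVm p q : 0 <= p -> p <= q -> hV p <= hV q by exact: (tvar_mono (sp_bv hsol)).
have Qm p q : 0 <= p -> p <= q -> Q p <= Q q.
  exact: (driver_mono rho_ge0 gamma_ge0 sol).
have hQm p q : 0 <= p -> p <= q -> hQ p <= hQ q.
  exact: (driver_mono rho_ge0 gamma_ge0 hsol).
have Wm p q : 0 <= p -> p <= q -> W p <= W q.
  move=> p0 pq; apply: lerD; last exact: hVm.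
  apply: lerD; last exact: Vm.
  by apply: lerD; [exact: Qm|exact: hQm].
have W0 : W 0 = 0.
  by rewrite /W /Q /hQ (tvar0 (sp_bv sol) : V 0 = 0) (tvar0 (sp_bv hsol) : hV 0 = 0); ring.
have cz : continuous_Rplus z.
  by apply: continuous_RplusD; [exact: (sp_cont_x sol)|apply: continuous_RplusN; exact: (sp_cont_x hsol)].
have [B HB] := bounded_path cz t0.
have B0 : 0 <= B by apply: le_trans (enorm_ge0 _) (HB 0 _); rewrite lexx.
pose c := 2 * (d%:R + 2 * B) + 2 : R.
have c0 : 0 <= c by rewrite /c addr_ge0// mulr_ge0// addr_ge0// mulr_ge0.
have small_const : 0 <= c / 4 * expR (4 * W T).
  by rewrite mulr_ge0 ?expR_ge0// divr_ge0.
apply: (le_of_small small_const) => e e0.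
have [h1 h10 H1] := uosc_path cz (lexx 0) t0 e0.
have [h2 h20 H2] := uosc_path (sp_cont_k sol) (lexx 0) t0 e0.
have [h3 h30 H3] := uosc_path (sp_cont_k hsol) (lexx 0) t0 e0.
pose F r := enorm (kap r - z0) ^+ 2.
(* A quarter of the inhomogeneous term 4 n0^2 + 2 n0 + e c. *)
pose A := n0 ^+ 2 + n0 / 2 + e * c / 4.
have A0 : 0 <= A.
  rewrite /A !addr_ge0 ?sqr_ge0//; first by rewrite divr_ge0.
  by rewrite divr_ge0// mulr_ge0// ltW.
pose P r := F r + A <= (F 0 + A) * expR (4 * W r).
have Pt : P t.
  apply: (@chain_induction _ 0 t (Num.min h1 (Num.min h2 h3)) P t0).
      by rewrite !lt_min h10 h20.
    move=> a b a0 ab bt; rewrite !lt_min => /andP[bh1 /andP[bh2 bh3]] Pa.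
    have at_ : a <= t := le_trans ab bt.
    have b0 : 0 <= b := le_trans a0 ab.
    set dk := kap b - kap a.
    have dW0 : 0 <= W b - W a by rewrite subr_ge0 Wm.
    have tested : - dot (z a) dk <=
        enorm (z a) ^+ 2 * (W b - W a) + e * ((d%:R + 2 * B) * (W b - W a)).
      apply: difference_increment => //; first exact: ltW.
        by move=> r /andP[ar rb]; apply: HB; rewrite (le_trans a0)// (le_trans rb).
      move=> r /andP[ar rb]; apply/ltW/H1.
      - by rewrite (le_trans a0)// (le_trans rb).
      - by rewrite a0.
      - by rewrite ger0_norm ?subr_ge0//; apply: le_lt_trans bh1; rewrite lerD2r.
    have dkE : dk = (k b - k a) - (hk b - hk a).
      by rewrite /dk /kap; apply/rowP => i; rewrite !mxE; ring.
    have dk_tri : enorm dk <= enorm (k b - k a) + enorm (hk b - hk a).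
      by rewrite dkE; apply: le_trans (enormD _ _) _; rewrite enormN.
    have dkW : enorm dk <= W b - W a.
      apply: le_trans dk_tri _.
      have := tvar_increment (sp_bv sol) a0 ab.
      have := tvar_increment (sp_bv hsol) a0 ab.
      rewrite -/(V a) -/(V b) -/(hV a) -/(hV b).
      have := Qm a b a0 ab; have := hQm a b a0 ab; rewrite /W; clear tested.
      move: (Q a) (Q b) (hQ a) (hQ b) (V a) (V b) (hV a) (hV b) => qa qb hqa hqb va vb hva hvb.
      by lra.
    have dk2e : enorm dk <= 2 * e.
      apply: le_trans dk_tri _; rewrite mulr_natl mulr2n.
      have bt0 : 0 <= b <= t by rewrite b0.
      have at0 : 0 <= a <= t by rewrite a0.
      by rewrite lerD//; apply: ltW; [apply: H2|apply: H3]; rewrite ?ger0_norm ?subr_ge0.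
    have dk2 : enorm dk ^+ 2 <= 2 * e * (W b - W a) by rewrite expr2 ler_pM ?enorm_ge0.
    have aT : 0 <= a <= T by rewrite a0 (le_trans at_).
    have dm : dot (m a - hm a) dk <= n0 * (W b - W a).
      by apply: le_trans (cauchy_schwarz _ _) _; rewrite ler_pM ?enorm_ge0 ?m_close.
    have kz : kap a - z0 = (m a - hm a) - z a.
      have e1 : k a = x0 + m a - x a by rewrite -(sp_eq sol a0) addrC addKr.
      have e2 : hk a = hx0 + hm a - hx a by rewrite -(sp_eq hsol a0) addrC addKr.
      by rewrite /kap e1 e2 /z0 /z; apply/rowP => i; rewrite !mxE; ring.
    have Fb : F b <= F a + (4 * F a + 4 * A) * (W b - W a).
      have za : enorm (z a) ^+ 2 <= 2 * F a + 2 * n0 ^+ 2.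
        have -> : z a = (m a - hm a) - (kap a - z0) by rewrite kz opprB addrCA subrr addr0.
        have nm := m_close aT.
        have nm2 : enorm (m a - hm a) ^+ 2 <= n0 ^+ 2 by rewrite ler_sqr ?nnegrE ?enorm_ge0.
        have := enormB_sqr_le (m a - hm a) (kap a - z0); rewrite -/(F a).
        move: nm2; clear tested dk2 dkW dk2e dk_tri dm Pa A0 c0 small_const nm dW0 n00.
        by move: (enorm _ ^+ 2) (enorm _ ^+ 2) (F a) => p q r; lra.
      have zaW := ler_wpM2r dW0 za.
      rewrite {1}/F (_ : kap b - z0 = (kap a - z0) + dk); last first.
        by rewrite /dk; apply/rowP => i; rewrite !mxE; ring.
      rewrite enormD_sqr -/(F a) {1}kz dotBl /A /c.
      move: tested dk2 dm zaW; clear za dkW dk2e dk_tri Pa A0 c0 small_const.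
      move: (F a) (W b - W a) (dot _ _) (dot _ _) (enorm _ ^+ 2) (enorm _ ^+ 2).
      by move=> f w p q r r'; lra.
    have A4 : 1 + 4 * (W b - W a) <= expR (4 * (W b - W a)) by exact: expR_ge1Dx.
    have FA0 : 0 <= F a + A by rewrite addr_ge0// sqr_ge0.
    rewrite /P (_ : 4 * W b = 4 * W a + 4 * (W b - W a)); last by ring.
    rewrite expRD mulrA.
    apply: (@le_trans _ _ ((F a + A) * expR (4 * (W b - W a)))); last first.
      by rewrite ler_wpM2r ?expR_ge0.
    apply: le_trans (ler_wpM2l FA0 A4).
    move: Fb; clear FA0 A4 tested dk2 dkW dk2e dk_tri dm Pa A0 c0 small_const n00 dW0.
    by move: (F a) (F b) (A) (W b - W a) => fa fb A' w; lra.
  by rewrite /P W0 mulr0 expR0 mulr1.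
have F0 : F 0 = enorm z0 ^+ 2.
  by rewrite /F /kap (sp_k0 sol) (sp_k0 hsol) subrr sub0r enormN.
have WT : expR (4 * W t) <= expR (4 * W T) by rewrite ler_expR ler_wpM2l// Wm.
have F00 : 0 <= F 0 + A by rewrite addr_ge0// sqr_ge0.
have := le_trans Pt (ler_wpM2l F00 WT); rewrite F0 -/(F t).
have := mulr_ge0 n00 (expR_ge0 (4 * W T)).
move: A0; rewrite /A; clear Pt F0 F00 WT small_const c0 B0.
by move: (F t) (c) (expR _) (enorm z0) => f c' E n; lra.
Qed.

End Stability.

(** * Bounds for solutions and the stability factor *)

Lemma square_split {R : realType} (u n q s : R) : 0 <= u -> 0 <= q ->
  q ^+ 2 = n -> n <= s -> u ^+ 2 + n ^+ 2 + n <= ((u + q) * (1 + s)) ^+ 2.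
Proof.
move=> u0 q0 q2 ns; have n0 : 0 <= n by rewrite -q2 sqr_ge0.
have h1 : n * (1 + n) <= n * (1 + s) by rewrite ler_wpM2l// lerD2l.
have h2 : u ^+ 2 <= u ^+ 2 * (1 + s) by rewrite ler_peMr ?sqr_ge0//; lra.
have h3 : (u ^+ 2 + n) * (1 + s) <= (u + q) ^+ 2 * (1 + s) ^+ 2.
  apply: ler_pM; [by rewrite addr_ge0 ?sqr_ge0|lra| |].
    by rewrite sqrrD q2; have := mulr_ge0 u0 q0; lra.
  by rewrite expr2 ler_peMr//; lra.
by rewrite exprMn; move: h1 h2 h3; lra.
Qed.

Lemma le_root_mul {R : realType} {n q s : R} : 0 <= q -> q ^+ 2 = n -> n <= s ->
  n <= q * (1 + s).
Proof.
move=> q0 q2 ns; have s0 : 0 <= s by rewrite (le_trans _ ns)// -q2 sqr_ge0.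
rewrite -q2 expr2 ler_wpM2l// -(ler_sqr q0) ?nnegrE ?addr_ge0// q2.
by rewrite sqrrD expr1n mul1r; have := sqr_ge0 s; lra.
Qed.

Section Bounds.
Local Set Implicit Arguments.
Local Unset Strict Implicit.
Context {R : realType} {d : nat} {rho gamma L delta sigma win C : R}.
Hypotheses (rho_ge0 : 0 <= rho) (gamma_ge0 : 0 <= gamma) (L_ge0 : 0 <= L)
  (sigma_gt0 : 0 < sigma) (delta_gt0 : 0 < delta).
Hypotheses (win_gt0 : 0 < win) (win_delta : win <= delta) (win_le1 : win <= 1)
  (win_gamma : 8 * gamma * win <= sigma).
Hypothesis C_growth : growth_const rho L sigma + 4 <= C.
Hypothesis C_osc : osc_const rho L sigma * delta ^+ 2 < C * win ^+ 2.
Context {phi : 'rV[R]_d -> \bar R}.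
Hypothesis phi_nNy : forall v, phi v != -oo%E.
Hypothesis phi_lsc : lower_semicontinuous phi.
Hypothesis phi_lip : forall u v, edom phi u -> edom phi v ->
  (`|phi u - phi v| <= (L + L * enorm (u - v)%R)%:E)%E.
Hypothesis ball_cond : shifted_interior_ball gamma delta sigma (edom phi).
Context {T : R}.
Hypothesis T_gt0 : 0 < T.

Lemma solution_bounds (x0 : 'rV[R]_d) (m x k : R -> 'rV[R]_d) :
  continuous_Rplus m -> skorohod_sol rho gamma phi x0 m x k ->
  let V r := fine (tvar k r) in
  [/\ V T <= CT delta C T m, sup_norm T m + V T <= CT delta C T m,
      T <= CT delta C T m &
   forall s t, 0 <= s -> s <= t -> t <= T ->
     enorm (x t - x s) + (V t - V s)
       <= CT delta C T m * Num.sqrt (mu_mod T m (t - s))].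
Proof.
move=> cm sol V.
apply: (@horizon_bounds _ _ x k m V rho gamma L delta sigma win T) => //.
- exact: (sp_cont_x sol).
- exact: increment_k sol.
- exact: tvar_increment (sp_bv sol).
- exact: tvar0 (sp_bv sol).
- move=> s t s0 st xd.
  exact: (window_tvar rho_ge0 gamma_ge0 L_ge0 phi_nNy phi_lsc phi_lip sol ball_cond s0 st xd).
- move=> s t alpha om s0 st xa mom.
  have := window_increment rho_ge0 gamma_ge0 L_ge0 phi_nNy phi_lsc phi_lip sol s0 st xa mom.
  rewrite -/(V t) -/(V s).
  by rewrite (_ : rho * t + _ - _ = rho * (t - s) + gamma * (V t - V s)) //; ring.
Qed.

Lemma path_bound (x0 : 'rV[R]_d) (m x k : R -> 'rV[R]_d) :
  continuous_Rplus m -> skorohod_sol rho gamma phi x0 m x k ->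
  sup_norm T x <= enorm x0 + CT delta C T m.
Proof.
move=> cm sol; have T0 := ltW T_gt0.
have [_ MV _ _] := solution_bounds cm sol.
apply: sup_norm_le => // r /andP[r0 rT].
have -> : x r = x0 + m r - k r by rewrite -(sp_eq sol r0) addrK.
apply: le_trans (enormD _ _) _; rewrite enormN.
have h1 := enormD x0 (m r).
have h2 : enorm (m r) <= sup_norm T m by apply: sup_norm_ge; rewrite ?r0.
have h3 : enorm (k r) <= fine (tvar k T).
  have := tvar_increment (sp_bv sol) (lexx 0) r0.
  rewrite (sp_k0 sol) subr0 (tvar0 (sp_bv sol)) subr0 => /le_trans; apply.
  exact: (tvar_mono (sp_bv sol)).
by move: MV h1 h2 h3; move: (CT _ _ _ _) (fine _) => c v; lra.
Qed.

(** The square root of the Gronwall factor is [exp (2 W T)], and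
    [W T <= (rho + gamma + 1) (ab.1 + ab.2)] when [ab] bounds [T] and the variations. *)
Definition stability_factor (ab : R * R) : R :=
  (2 * expR (2 * (rho + gamma + 1) * (ab.1 + ab.2)) + 1) * (1 + (ab.1 + ab.2)).

Lemma stability_factor_continuous : continuous stability_factor.
Proof.
have sum_cont : continuous (fun ab : R * R => ab.1 + ab.2).
  by move=> ab; apply: cvgD; [exact: cvg_fst|exact: cvg_snd].
move=> ab; apply: cvgM; last by apply: cvgD; [exact: cvg_cst|exact: sum_cont].
apply: cvgD; last exact: cvg_cst.
apply: cvgM; first exact: cvg_cst.
apply: (continuous_comp (f := fun ab : R * R => 2 * (rho + gamma + 1) * (ab.1 + ab.2)) (g := expR)).
  by apply: cvgM; [exact: cvg_cst|exact: sum_cont].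
exact: continuous_expR.
Qed.

Lemma stability (x0 hx0 : 'rV[R]_d) (m x k hm hx hk : R -> 'rV[R]_d) :
  continuous_Rplus m -> continuous_Rplus hm ->
  skorohod_sol rho gamma phi x0 m x k ->
  skorohod_sol rho gamma phi hx0 hm hx hk ->
  sup_norm T (fun r => x r - hx r) + sup_norm T (fun r => k r - hk r)
    <= stability_factor (CT delta C T m, CT delta C T hm) *
       (enorm (x0 - hx0) + Num.sqrt (sup_norm T (fun r => m r - hm r))).
Proof.
move=> cm chm sol hsol; have T0 := ltW T_gt0.
have [VT MV TC _] := solution_bounds cm sol.
have [hVT hMV hTC _] := solution_bounds chm hsol.
rewrite /stability_factor /=.
set a := CT delta C T m in VT MV TC *; set b := CT delta C T hm in hVT hMV hTC *.
have cn : continuous_Rplus (fun r => m r - hm r).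
  by apply: continuous_RplusD => //; exact: continuous_RplusN.
set n0 := sup_norm T (fun r => m r - hm r).
have mn r : 0 <= r <= T -> enorm (m r - hm r) <= n0 by exact: sup_norm_ge.
have n00 : 0 <= n0 by apply: sup_norm_ge0.
have V0 : 0 <= fine (tvar k T).
  by rewrite -(tvar0 (sp_bv sol)); exact: (tvar_mono (sp_bv sol)).
have hV0 : 0 <= fine (tvar hk T).
  by rewrite -(tvar0 (sp_bv hsol)); exact: (tvar_mono (sp_bv hsol)).
set s := a + b.
have n0s : n0 <= s.
  apply: sup_norm_le => // r rT; apply: le_trans (enormD _ _) _; rewrite enormN.
  have h1 := sup_norm_ge cm rT; have h2 := sup_norm_ge chm rT.
  by move: MV hMV V0 hV0 h1 h2; rewrite /s; clear VT hVT TC hTC mn n00; lra.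
have s0 : 0 <= s := le_trans n00 n0s.
set z0 := enorm (x0 - hx0); have z00 : 0 <= z0 := enorm_ge0 _.
set q := Num.sqrt n0; have q0 : 0 <= q := sqrtr_ge0 _.
have q2 : q ^+ 2 = n0 by rewrite sqr_sqrtr.
set E := expR (2 * (rho + gamma + 1) * s).
have E0 : 0 <= E := expR_ge0 _.
pose G := (z0 + q) * (1 + s) * E.
have s1 : 1 <= 1 + s by lra.
have zq0 : 0 <= z0 + q by rewrite addr_ge0.
have s10 : 0 <= 1 + s := le_trans ler01 s1.
have G0 : 0 <= G by apply: mulr_ge0 => //; exact: mulr_ge0.
have kG r : 0 <= r <= T -> enorm ((k r - hk r) - (x0 - hx0)) <= G.
  move=> rT; rewrite -(ler_sqr (enorm_ge0 _)) ?nnegrE//.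
  apply: le_trans (stieltjes_gronwall rho_ge0 gamma_ge0 sol hsol T0 mn rT) _.
  rewrite -/z0 /G exprMn; apply: ler_pM.
  - by rewrite -q2; do 2?[apply: addr_ge0]; rewrite ?sqr_ge0.
  - exact: expR_ge0.
  - exact: square_split.
  rewrite -expRM_natl ler_expR (_ : 2%:R * _ = 4 * ((rho + gamma + 1) * s)); last by ring.
  apply: ler_wpM2l => //.
  have h1 := ler_wpM2l rho_ge0 TC.
  have h2 := ler_wpM2l rho_ge0 hTC.
  have h3 := ler_wpM2l gamma_ge0 VT.
  have h4 := ler_wpM2l gamma_ge0 hVT.
  by move: h1 h2 h3 h4 VT hVT; rewrite /s; clear MV hMV mn n00 n0s V0 hV0 s0 z00 q0 q2 E0 s1 zq0 s10 G0; move: (a) (b) (fine _) (fine _) => a' b' v hv; lra.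
have xG : sup_norm T (fun r => x r - hx r) <= n0 + G.
  apply: sup_norm_le => // r /[dup] rT /andP[r0 _].
  have -> : x r - hx r = (m r - hm r) - ((k r - hk r) - (x0 - hx0)).
    have -> : x r = x0 + m r - k r by rewrite -(sp_eq sol r0) addrK.
    have -> : hx r = hx0 + hm r - hk r by rewrite -(sp_eq hsol r0) addrK.
    by apply/rowP => i; rewrite !mxE; ring.
  by apply: le_trans (enormD _ _) _; rewrite enormN lerD ?mn ?kG.
have kkG : sup_norm T (fun r => k r - hk r) <= G + z0.
  apply: sup_norm_le => // r rT.
  rewrite -[k r - hk r](subrK (x0 - hx0)).
  by apply: le_trans (enormD _ _) _; rewrite lerD2r kG.
have n0q : n0 <= q * (1 + s) := le_root_mul q0 q2 n0s.
have z0s : z0 <= z0 * (1 + s) by apply: ler_peMr.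
move: xG kkG n0q z0s; rewrite /G; clear kG; move: (sup_norm _ _) (sup_norm _ _) => sx sk.
by move: (E) (n0) (s) (q) (z0) => *; lra.
Qed.

End Bounds.

Theorem theorem23 (R : realType) (d : nat) (rho gamma L delta sigma : R)
    (rho_ge0 : 0 <= rho) (gamma_ge0 : 0 <= gamma) (L_ge0 : 0 <= L)
    (delta_gt0 : 0 < delta) (sigma_gt0 : 0 < sigma) :
  exists (C : R) (A : R * R -> R),
    [/\ 0 < C, continuous A &
    forall phi : 'rV[R]_d -> \bar R,
      (forall v, phi v != -oo%E) ->
      proper_fun phi ->
      lower_semicontinuous phi ->
      fun_semiconvex rho gamma phi ->
      (forall u v, edom phi u -> edom phi v ->
         (`|phi u - phi v| <= (L + L * enorm (u - v)%R)%:E)%E) ->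
      shifted_interior_ball gamma delta sigma (edom phi) ->
    forall (x0 : 'rV[R]_d) (m : R -> 'rV[R]_d) (T : R),
      closure (edom phi) x0 -> continuous_Rplus m -> m 0 = 0 -> 0 < T ->
    forall x k : R -> 'rV[R]_d,
      skorohod_sol rho gamma phi x0 m x k ->
      [/\ bv_norm k T = tvar k T /\ (tvar k T <= (CT delta C T m)%:E)%E,
          sup_norm T x <= enorm x0 + CT delta C T m,
          forall s t : R, 0 <= s -> s <= t -> t <= T ->
            ((enorm (x t - x s)%R)%:E + tvar k t - tvar k s
              <= (CT delta C T m * Num.sqrt (mu_mod T m (t - s)))%:E)%E &
          forall (hx0 : 'rV[R]_d) (hm hx hk : R -> 'rV[R]_d),
            closure (edom phi) hx0 -> continuous_Rplus hm -> hm 0 = 0 ->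
            skorohod_sol rho gamma phi hx0 hm hx hk ->
            sup_norm T (fun r => x r - hx r) + sup_norm T (fun r => k r - hk r)
              <= A (CT delta C T m, CT delta C T hm) *
                 (enorm (x0 - hx0) +
                  Num.sqrt (sup_norm T (fun r => m r - hm r)))]].
Proof.
pose g1 := 8 * gamma + 1; have g10 : 0 < g1 by rewrite /g1; lra.
(* The divisor 8 gamma + 1 rather than 8 gamma allows gamma = 0. *)
pose win := Num.min (Num.min delta 1) (sigma / g1).
have win0 : 0 < win by rewrite !lt_min delta_gt0 ltr01 divr_gt0.
have win_delta : win <= delta by rewrite /win !ge_min lexx.
have win1 : win <= 1 by rewrite /win !ge_min lexx orbT.
have win_gamma : 8 * gamma * win <= sigma.
  have : g1 * win <= sigma.
    by rewrite mulrC -ler_pdivlMr// /win ge_min lexx orbT.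
  by rewrite /g1; lra.
have step1 := step_const_ge1 rho_ge0 L_ge0 sigma_gt0.
have square1 : 1 <= square_const rho L sigma := square_const_ge1 rho_ge0 L_ge0.
pose D := osc_const rho L sigma * delta ^+ 2 / win ^+ 2.
have D0 : 0 <= D.
  by rewrite /D divr_ge0 ?sqr_ge0// mulr_ge0 ?sqr_ge0// /osc_const; lra.
pose C := growth_const rho L sigma + 4 + D + 1.
have C_growth : growth_const rho L sigma + 4 <= C by rewrite /C; lra.
have C_osc : osc_const rho L sigma * delta ^+ 2 < C * win ^+ 2.
  rewrite -ltr_pdivrMr ?exprn_gt0// -/D /C /growth_const; lra.
exists C, (stability_factor (rho := rho) (gamma := gamma)); split.
- by rewrite /C /growth_const; lra.
- exact: stability_factor_continuous.
move=> phi phi_nNy _ phi_lsc _ phi_lip ball_cond x0 m T _ cm _ T0 x k sol.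
have bounds := solution_bounds rho_ge0 gamma_ge0 L_ge0 sigma_gt0 delta_gt0 win0
  win_delta win1 win_gamma C_growth C_osc phi_nNy phi_lsc phi_lip ball_cond T0.
have [VT _ _ incr] := bounds x0 m x k cm sol.
have fin t : 0 <= t -> tvar k t = (fine (tvar k t))%:E.
  by move=> t0; rewrite fineK//; exact: tvar_fin (sp_bv sol) _ t0.
split.
- split; first by rewrite /bv_norm (sp_k0 sol) enorm0 add0e.
  by rewrite (fin _ (ltW T0)) lee_fin.
- exact: (path_bound rho_ge0 gamma_ge0 L_ge0 sigma_gt0 delta_gt0 win0
    win_delta win1 win_gamma C_growth C_osc phi_nNy phi_lsc phi_lip ball_cond T0 cm sol).
- move=> s t s0 st tT; rewrite (fin s)// (fin t) ?(le_trans s0)//.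
  have := incr s t s0 st tT; rewrite -lee_fin; apply: le_trans.
  by rewrite addrA EFinB EFinD.
- move=> hx0 hm hx hk _ chm _ hsol.
  exact: (stability rho_ge0 gamma_ge0 L_ge0 sigma_gt0 delta_gt0 win0
    win_delta win1 win_gamma C_growth C_osc phi_nNy phi_lsc phi_lip ball_cond T0 cm chm sol hsol).
Qed.
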